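(* Let $(m_{-\infty},m_\infty,n_{-\infty},n_\infty)\in\mathbb{R}^4$ satisfy $m_{-\infty}<m_\infty$ and $n_\infty<n_{-\infty}$, and let $m_*\le m_{-\infty}$, $n_*\le n_\infty$ be real. (1) If a time-invariant strategy pair $\{(b_i,a_i):i\in\mathbb{Z}\}$ is a Nash equilibrium of $\mathrm{Trail}(m_{-\infty},m_\infty,n_{-\infty},n_\infty)$, then the associated quadruple $\{(a_i,b_i,m_i,n_i):i\in\mathbb{Z}\}$ is a positive ABMN solution with boundary data $(m_{-\infty},m_\infty,n_{-\infty},n_\infty)$. (2) Conversely, if $\{(a_i,b_i,m_i,n_i)\in(0,\infty)^2\times\mathbb{R}^2:i\in\mathbb{Z}\}$ is a positive ABMN solution with boundary data $(m_{-\infty},m_\infty,n_{-\infty},n_\infty)$, then the time-invariant strategy pair $\{(b_i,a_i):i\in\mathbb{Z}\}$ (Mina stakes $b_i$, Maxine stakes $a_i$ at site $i$) is a Nash equilibrium of $\mathrm{Trail}(m_{-\infty},m_\infty,n_{-\infty},n_\infty)$.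
   Context: Trail of Lost Pennies $\mathrm{Trail}(m_{-\infty},m_\infty,n_{-\infty},n_\infty)$: the data satisfy $m_{-\infty}<m_\infty$, $n_\infty<n_{-\infty}$, and fixed reals $m_*\le m_{-\infty}$, $n_*\le n_\infty$. A strategy is a map $S:\mathbb{Z}\times\mathbb{N}_+\to[0,\infty)$; it is time-invariant if $S(i,j)$ does not depend on $j$. For a strategy pair $(S_-,S_+)$ (Mina's, Maxine's) and $k\in\mathbb{Z}$, gameplay is the random process $X:\mathbb{N}\to\mathbb{Z}$ with $X_0=k$ such that, given $X_0,\dots,X_{i-1}$, $X_i=X_{i-1}+1$ with probability $\frac{S_+(X_{i-1},i)}{S_-(X_{i-1},i)+S_+(X_{i-1},i)}$ and $X_i=X_{i-1}-1$ otherwise (with the convention $0/0=1/2$). Let $E_-=\{\limsup_n X_n=-\infty\}$, $E_+=\{\liminf_nX_n=\infty\}$, $E=E_-\cup E_+$. Mina's payoff is $P_-=-\sum_{t\ge1}S_-(X_{t-1},t)+T_-$ with $T_-=n_{-\infty}$ on $E_-$, $n_\infty$ on $E_+$, $n_*$ on $E^c$; Maxine's payoff is $P_+=-\sum_{t\ge1}S_+(X_{t-1},t)+T_+$ with $T_+=m_{-\infty}$ on $E_-$, $m_\infty$ on $E_+$, $m_*$ on $E^c$. Write $\mathbb{E}^k_{S_-,S_+}$ for expectation (values in $\mathbb{R}\cup\{-\infty\}$ allowed). $(S_-,S_+)$ is a Nash equilibrium if for every strategy $S$ and every $k\in\mathbb{Z}$: $\mathbb{E}^k_{S_-,S_+}[P_+]\ge\mathbb{E}^k_{S_-,S}[P_+]$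 and $\mathbb{E}^k_{S_-,S_+}[P_-]\ge\mathbb{E}^k_{S,S_+}[P_-]$ (alternative strategies need not be time-invariant). A time-invariant pair is identified with sequences $\{(b_i,a_i)\}$, $b_i=S_-(i,\cdot)$, $a_i=S_+(i,\cdot)$; its associated quadruple is $\{(a_i,b_i,m_i,n_i)\}$ with $m_i=\mathbb{E}^i_{S_-,S_+}[P_+]$, $n_i=\mathbb{E}^i_{S_-,S_+}[P_-]$. The ABMN system on $\mathbb{Z}$: real variables $a_i,b_i\ge0$, $m_i,n_i$ with, for every $i$, $(a_i+b_i)(m_i+a_i)=a_im_{i+1}+b_im_{i-1}$; $(a_i+b_i)(n_i+b_i)=a_in_{i+1}+b_in_{i-1}$; $(a_i+b_i)^2=b_i(m_{i+1}-m_{i-1})$; $(a_i+b_i)^2=a_i(n_{i-1}-n_{i+1})$. Positive means $a_i,b_i>0$ for all $i$; boundary data $(m_{-\infty},m_\infty,n_{-\infty},n_\infty)$ are the limits of $m_{-k},m_k,n_{-k},n_k$ as $k\to\infty$. *)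

(* Defs.v *)
From HB Require Import structures.
From mathcomp Require Import all_boot all_order all_algebra.
From mathcomp Require Import all_classical all_reals all_analysis.
Set Implicit Arguments. Unset Strict Implicit. Unset Printing Implicit Defensive.
Import Order.TTheory GRing.Theory Num.Theory.
Import numFieldNormedType.Exports.
Local Open Scope classical_set_scope.
Local Open Scope ring_scope.

Section Trail.
Variable R : realType.

(* A strategy S : Z x N_+ -> [0,oo).  [S i t] is the stake at site i at time t;
   the value at t = 0 is never used. *)
Definition strategy := int -> nat -> R.
Definition is_strategy (S : strategy) := forall i t, 0 <= S i t.
Definition time_invariant (c : int -> R) : strategy := fun i _ => c i.

(* probability of an up-step at site x at time t, with 0/0 = 1/2 *)
Definition pup (Sm Sp : strategy) (x : int) (t : nat) : R :=
  if Sm x t + Sp x t == 0 then 2^-1 else Sp x t / (Sm x t + Sp x t).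

(* Gameplay realised on ([0,1], Lebesgue): the state after t steps is
   (X_t, l_t, r_t); conditionally on X_0..X_t, u is uniform on [l_t, r_t),
   and the (t+1)-th step is up iff u < l_t + pup * (r_t - l_t). *)
Fixpoint walk (Sm Sp : strategy) (k : int) (u : R) (t : nat) : int * R * R :=
  match t with
  | 0 => (k, 0, 1)
  | t'.+1 =>
      let: (x, l, r) := walk Sm Sp k u t' in
      let c := l + pup Sm Sp x t'.+1 * (r - l) in
      if u < c then (x + 1, l, c) else (x - 1, c, r)
  end.

Definition X (Sm Sp : strategy) (k : int) (u : R) (t : nat) : int :=
  (walk Sm Sp k u t).1.1.

Definition Eminus (x : nat -> int) : Prop :=
  forall M : int, exists N : nat, forall n, (N <= n)%N -> (x n < M)%R.
Definition Eplus (x : nat -> int) : Prop :=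
  forall M : int, exists N : nat, forall n, (N <= n)%N -> (M < x n)%R.

Definition terminal (lo hi star : R) (x : nat -> int) : R :=
  if `[< Eminus x >] then lo else if `[< Eplus x >] then hi else star.

Local Open Scope ereal_scope.

Definition total_stake (S : strategy) (x : nat -> int) : \bar R :=
  \sum_(1 <= t <oo) (S (x t.-1) t)%:E.

Definition payoff_minus (nlo nhi ns : R) (Sm Sp : strategy) (k : int) (u : R)
  : \bar R :=
  - total_stake Sm (X Sm Sp k u) + (terminal nlo nhi ns (X Sm Sp k u))%:E.
Definition payoff_plus (mlo mhi ms : R) (Sm Sp : strategy) (k : int) (u : R)
  : \bar R :=
  - total_stake Sp (X Sm Sp k u) + (terminal mlo mhi ms (X Sm Sp k u))%:E.

Definition Eminus_payoff (nlo nhi ns : R) (Sm Sp : strategy) (k : int) : \bar R :=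
  \int[@lebesgue_measure R]_(u in `[0%R, 1%R]) payoff_minus nlo nhi ns Sm Sp k u.
Definition Eplus_payoff (mlo mhi ms : R) (Sm Sp : strategy) (k : int) : \bar R :=
  \int[@lebesgue_measure R]_(u in `[0%R, 1%R]) payoff_plus mlo mhi ms Sm Sp k u.

Definition Nash (mlo mhi nlo nhi ms ns : R) (Sm Sp : strategy) : Prop :=
  forall (S : strategy), is_strategy S -> forall k : int,
    Eplus_payoff mlo mhi ms Sm S k <= Eplus_payoff mlo mhi ms Sm Sp k /\
    Eminus_payoff nlo nhi ns S Sp k <= Eminus_payoff nlo nhi ns Sm Sp k.

Local Close Scope ereal_scope.

Definition ABMN (a b m n : int -> R) : Prop :=
  forall i : int,
    [/\ 0 <= a i, 0 <= b i &
        (a i + b i) * (m i + a i) = a i * m (i + 1) + b i * m (i - 1)] /\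
    [/\ (a i + b i) * (n i + b i) = a i * n (i + 1) + b i * n (i - 1),
        (a i + b i) ^+ 2 = b i * (m (i + 1) - m (i - 1)) &
        (a i + b i) ^+ 2 = a i * (n (i - 1) - n (i + 1))].

Definition positive_sol (a b : int -> R) : Prop := forall i, 0 < a i /\ 0 < b i.

Definition boundary_data (m n : int -> R) (mlo mhi nlo nhi : R) : Prop :=
  [/\ (fun k : nat => m (- k%:Z)) @ \oo --> mlo,
      (fun k : nat => m k%:Z) @ \oo --> mhi,
      (fun k : nat => n (- k%:Z)) @ \oo --> nlo &
      (fun k : nat => n k%:Z) @ \oo --> nhi].

Definition positive_ABMN_bd (a b m n : int -> R) (mlo mhi nlo nhi : R) : Prop :=
  [/\ ABMN a b m n, positive_sol a b & boundary_data m n mlo mhi nlo nhi].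

End Trail.

(* Main.v *)
Require Import Defs.
From HB Require Import structures.
From mathcomp Require Import all_boot all_order all_algebra.
From mathcomp Require Import all_classical all_reals all_analysis.
From mathcomp Require Import measurable_realfun.
From mathcomp Require Import lra ring zify.
Import Order.TTheory GRing.Theory Num.Theory.
Import numFieldNormedType.Exports.
Set Implicit Arguments. Unset Strict Implicit. Unset Printing Implicit Defensive.
Local Open Scope classical_set_scope.
Local Open Scope ring_scope.

(**
  For a player with value function [v], terminal values bounded by [K], and
  stakes [S], we work with the nonnegative cost (total stake) + K - (terminal
  value), whose expectation is [K] minus the expected payoff. Splitting [0,1]
  at the first up-probability and rescaling both halves gives the first-step
  equation of the walk.

  From ABMN to Nash: [v (X_t)] minus the past stakes is a supermartingale under
  any deviation and a martingale at equilibrium. Deviations are bounded by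
  dominated convergence, a path that does not escape only lowering the payoff.
  At equilibrium the expected total stake is finite and the stakes are positive,
  so each site is visited finitely often and the walk escapes almost surely.

  From Nash to ABMN: one-shot deviations show that at each site either both
  players stake zero and [m] is nonincreasing there, or both stakes are positive
  and the ABMN equations hold, so that [m] is increasing there. Hence all sites
  are of the same kind; if no one ever staked, each player could win at
  arbitrarily small cost. In the positive case let [m'], [n'] be the limits of
  [m], [n], and [q] the probability of escaping to the right from [k]. Then
  [(1 - q) m'_lo + q m'_hi = (1 - q) mlo + q mhi >= m_k], and likewise for [n].
  The inequalities force [q] above [1/2] far to the right and below [1/2] far
  to the left, and two distinct values of [q] identify the limits.
*)

(** * Affine changes of variable *)

Section Affine.
Context {R : realType}.
Local Notation mu := (@lebesgue_measure R).
Local Open Scope ereal_scope.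

Definition affine (c d : R) (x : measurableTypeR R) : measurableTypeR R :=
  (c * x + d)%R.

Lemma measurable_affine c d : measurable_fun setT (affine c d).
Proof.
by apply: measurable_funD => //; apply: measurable_funM.
Qed.

Lemma affine_preimage_oc c d a b : (0 < c)%R ->
  affine c d @^-1` `]a, b]%classic = `]((a - d) / c)%R, ((b - d) / c)%R]%classic.
Proof.
move=> c0; apply/seteqP; split => x; rewrite /= !in_itv/= /affine.
  by rewrite ltr_pdivrMr// ler_pdivlMr// ltrBlDr lerBrDr (mulrC x).
by rewrite ltr_pdivrMr// ler_pdivlMr// ltrBlDr lerBrDr (mulrC x).
Qed.

(** Lebesgue measure is determined by its values on the intervals []a, b]]. The image of [mu] under
    the affine map, scaled by [c], has the same values there, so the formula is the change of
    variables for a pushforward. *)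
Lemma ge0_integral_affine c d (f : R -> \bar R) : (0 < c)%R ->
  measurable_fun setT f -> (forall x, 0 <= f x) ->
  \int[mu]_x f x = c%:E * \int[mu]_x f (c * x + d)%R.
Proof.
move=> c0 mf f0; have ma := measurable_affine c d.
have : exists nu : {measure set measurableTypeR R -> \bar R},
    nu = pushforward mu (affine c d) :> (set _ -> _).
  by eexists; unshelve reflexivity.
move=> [nu nuE].
have nu_mu A : measurable A -> mu A = mscale (NngNum (ltW c0)) nu A.
  move=> mA; apply: lebesgue_measure_unique mA => /= _ [[a b]] _ <-.
  rewrite /mscale nuE /pushforward affine_preimage_oc//= !lebesgue_measure_itv/=.
  rewrite !lte_fin ltr_pM2r ?invr_gt0// ltrD2r; case: ifP => ab; last by rewrite mule0.
  by rewrite -!EFinD -EFinM; congr (_%:E); field; rewrite gt_eqF.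
rewrite (@eq_measure_integral _ _ _ _ (mscale (NngNum (ltW c0)) nu)); last first.
  by move=> A mA _; exact: nu_mu.
rewrite ge0_integral_mscale//=; congr (_ * _).
by rewrite nuE (ge0_integral_pushforward ma).
Qed.

(** Half-open intervals let two such pieces be glued without overlap. For [c = 0] both sides
    vanish. *)
Lemma ge0_integral_affine_co c d (f : R -> \bar R) : (0 <= c)%R ->
  measurable_fun setT f -> (forall x, 0 <= f x) ->
  \int[mu]_(x in `[d, (d + c)%R[) f x =
  c%:E * \int[mu]_(x in `[0%R, 1%R]) f (c * x + d)%R.
Proof.
rewrite le_eqVlt => /predU1P[<-|c0] mf f0.
  by rewrite mul0e addr0 set_itvco0 integral_set0.
rewrite -[in RHS]integral_itv_bndo_bndc; last first.
  apply: measurable_funTS; apply: (measurableT_comp mf).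
  exact: measurable_affine.
rewrite integral_mkcond (@ge0_integral_affine c d)//; last 2 first.
  - by apply/(measurable_restrictT _ _).1 => //; exact: measurable_funTS.
  - by move=> x; rewrite patchE; case: ifP.
congr (_ * _); rewrite [RHS]integral_mkcond; apply: eq_integral => x _.
rewrite !patchE !mem_setE !in_itv/=; congr (if _ then _ else _).
by rewrite lerDr pmulr_rge0// [(d + c)%R]addrC ltrD2r gtr_pMr.
Qed.

Lemma ge0_integral_split01 p (f : R -> \bar R) : (0 <= p <= 1)%R ->
  measurable_fun setT f -> (forall x, 0 <= f x) ->
  \int[mu]_(x in `[0%R, 1%R]) f x =
  p%:E * \int[mu]_(x in `[0%R, 1%R]) f (p * x)%R +
  (1 - p)%:E * \int[mu]_(x in `[0%R, 1%R]) f ((1 - p) * x + p)%R.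
Proof.
move=> /andP[p0 p1] mf f0.
have mfT := fun D => @measurable_funTS _ _ _ _ D _ mf.
rewrite -integral_itv_bndo_bndc//.
rewrite (_ : `[0%R, 1%R[%classic = `[0%R, p[%classic `|` `[p, 1%R[%classic); last first.
  by rewrite -itv_bndbnd_setU//= bnd_simp.
rewrite ge0_integral_setU//; [|exact: mfT|]; last first.
  apply/disj_setPS => x [] /=; rewrite !in_itv/= => /andP[_ xp] /andP[px _].
  by have := lt_le_trans xp px; rewrite ltxx.
congr (_ + _).
  have := @ge0_integral_affine_co p 0%R f p0 mf f0.
  by rewrite add0r => ->; under eq_integral do rewrite addr0.
have := @ge0_integral_affine_co (1 - p)%R p f _ mf f0.
by rewrite [(p + _)%R]addrC subrK => -> //; rewrite subr_ge0.
Qed.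

End Affine.

(** * The walk and its shifts *)

Section Walk.
Context {R : realType}.
Implicit Types (S Sm Sp : strategy R) (k : int) (u : R).

Definition shift_strategy S : strategy R := fun i t => S i t.+1.

Lemma pup_ge0_le1 Sm Sp x t : is_strategy Sm -> is_strategy Sp ->
  0 <= pup Sm Sp x t <= 1.
Proof.
move=> hm hp; rewrite /pup; case: eqP => [_|/eqP s0]; first lra.
have s1 : 0 < Sm x t + Sp x t by rewrite lt_neqAle eq_sym s0 addr_ge0.
apply/andP; split; first by apply: divr_ge0; [exact: hp|exact: ltW].
by rewrite ler_pdivrMr// mul1r lerDr.
Qed.

(** The increasing map [u |-> p * u] carries each cell [[l, r)] of the shifted walk to a cell of the
    original one, so every later comparison with a threshold has the same outcome; [u < 1] makes the
    first step go up. *)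
Lemma walk_shift_up Sm Sp k u t (p := pup Sm Sp k 1) : 0 < p -> u < 1 ->
  walk Sm Sp k (p * u) t.+1 =
  let: (x, l, r) := walk (shift_strategy Sm) (shift_strategy Sp) (k + 1) u t in
  (x, p * l, p * r).
Proof.
move=> p0 u1; elim: t => [|t IH].
  by rewrite /= add0r subr0 mulr1 -/p gtr_pMr// u1 mulr0.
rewrite [LHS]/= -/(walk Sm Sp k (p * u) t.+1) IH.
rewrite [in RHS]/=; case: (walk _ _ (k + 1) u t) => [[x l] r].
rewrite (_ : _ + _ * (p * r - p * l) =
  p * (l + pup (shift_strategy Sm) (shift_strategy Sp) x t.+1 * (r - l))).
  by rewrite ltr_pM2l//; case: ifP.
by rewrite -[pup (shift_strategy _) _ _ _]/(pup Sm Sp x t.+2); ring.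
Qed.

Lemma walk_shift_down Sm Sp k u t (p := pup Sm Sp k 1) : p < 1 -> 0 <= u ->
  walk Sm Sp k ((1 - p) * u + p) t.+1 =
  let: (x, l, r) := walk (shift_strategy Sm) (shift_strategy Sp) (k - 1) u t in
  (x, (1 - p) * l + p, (1 - p) * r + p).
Proof.
move=> p1 u0; have q0 : 0 < 1 - p by rewrite subr_gt0.
elim: t => [|t IH].
  have qu : 0 <= (1 - p) * u by rewrite mulr_ge0// ltW.
  rewrite /= add0r subr0 mulr1 -/p ltNge lerDr qu /=.
  by rewrite mulr0 add0r mulr1 subrK.
rewrite [LHS]/= -/(walk Sm Sp k ((1 - p) * u + p) t.+1) IH.
rewrite [in RHS]/=; case: (walk _ _ (k - 1) u t) => [[x l] r].
rewrite (_ : _ + _ * ((1 - p) * r + p - _) =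
  (1 - p) * (l + pup (shift_strategy Sm) (shift_strategy Sp) x t.+1 * (r - l)) + p).
  by rewrite ltrD2r ltr_pM2l//; case: ifP.
by rewrite -[pup (shift_strategy _) _ _ _]/(pup Sm Sp x t.+2); ring.
Qed.

Definition path_cons k (x : nat -> int) : nat -> int :=
  fun t => if t is t'.+1 then x t' else k.

Lemma X_up Sm Sp k u : 0 < pup Sm Sp k 1 -> u < 1 ->
  X Sm Sp k (pup Sm Sp k 1 * u) =
  path_cons k (X (shift_strategy Sm) (shift_strategy Sp) (k + 1) u).
Proof.
move=> p0 u1; apply/funext => -[//|t]; rewrite /X walk_shift_up//=.
by case: (walk _ _ (k + 1) u t) => [[]].
Qed.

Lemma X_down Sm Sp k u : pup Sm Sp k 1 < 1 -> 0 <= u ->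
  X Sm Sp k ((1 - pup Sm Sp k 1) * u + pup Sm Sp k 1) =
  path_cons k (X (shift_strategy Sm) (shift_strategy Sp) (k - 1) u).
Proof.
move=> p0 u1; apply/funext => -[//|t]; rewrite /X walk_shift_down//=.
by case: (walk _ _ (k - 1) u t) => [[]].
Qed.

Lemma X_step Sm Sp k u t : X Sm Sp k u t.+1 = X Sm Sp k u t + 1 \/
  X Sm Sp k u t.+1 = X Sm Sp k u t - 1.
Proof.
by rewrite /X/=; case: (walk _ _ _ _ t) => [[x l] r]; case: ifP; [left|right].
Qed.

Lemma eq_X Sm Sp Sm' Sp' k : (forall i t, Sm i t.+1 = Sm' i t.+1) ->
  (forall i t, Sp i t.+1 = Sp' i t.+1) -> X Sm Sp k = X Sm' Sp' k.
Proof.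
move=> hm hp; apply/funext => u; apply/funext => t; rewrite /X; congr (_.1.1).
elim: t => //= t ->; case: (walk _ _ _ _ t) => [[x l] r].
by rewrite /pup hm hp.
Qed.

(* No structure is needed on the type of walk states: each state is reached
   through finitely many comparisons of [u] with previous states. *)
Lemma measurable_walk d (T : measurableType d) Sm Sp k t (g : int * R * R -> T) :
  measurable_fun [set: R] (fun u => g (walk Sm Sp k u t)).
Proof.
elim: t d T g => [|t IH] d T g /=; first exact: measurable_cst.
pose c (w : int * R * R) := w.1.2 + pup Sm Sp w.1.1 t.+1 * (w.2 - w.1.2).
pose g1 w := g (w.1.1 + 1, w.1.2, c w).
pose g2 w := g (w.1.1 - 1, c w, w.2).
rewrite [X in measurable_fun _ X](_ : _ = fun u =>
    if u < c (walk Sm Sp k u t) then g1 (walk Sm Sp k u t)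
    else g2 (walk Sm Sp k u t)).
  apply: measurable_fun_ifT; [|exact: IH|exact: IH].
  apply: measurable_fun_ltr; [exact: measurable_id|exact: IH].
apply/funext => u; rewrite /g1 /g2 /c.
by case: (walk Sm Sp k u t) => [[x l] r] /=; case: ifP.
Qed.

Lemma measurable_X d (T : measurableType d) Sm Sp k t (g : int -> T) :
  measurable_fun [set: R] (fun u => g (X Sm Sp k u t)).
Proof. exact: (@measurable_walk _ T Sm Sp k t (fun w => g w.1.1)). Qed.

Lemma measurable_X_set Sm Sp k t (P : int -> bool) :
  measurable [set u | P (X Sm Sp k u t)].
Proof.
have := @measurable_X _ _ Sm Sp k t P measurableT [set true] (I : measurable [set true]).
by rewrite setTI.
Qed.

(** Natural-number thresholds present the event as a countable combination of conditions on single
    times, the form needed by [measurable_eventually]. *)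
Lemma EminusP (x : nat -> int) :
  Eminus x <-> forall j, exists N, forall n, (N <= n)%N -> x n < - j%:Z.
Proof.
split=> [h j|h M]; first exact: h.
have [N hN] := h `|M|%N; exists N => n /hN; lia.
Qed.

Lemma EplusP (x : nat -> int) :
  Eplus x <-> forall j, exists N, forall n, (N <= n)%N -> j%:Z < x n.
Proof.
split=> [h j|h M]; first exact: h.
have [N hN] := h `|M|%N; exists N => n /hN; lia.
Qed.

Lemma measurable_eventually (P : nat -> int -> bool) Sm Sp k :
  measurable [set u | forall j, exists N, forall n, (N <= n)%N ->
    P j (X Sm Sp k u n)].
Proof.
rewrite (_ : [set u | _] = \bigcap_j \bigcup_N \bigcap_n
    [set u | (N <= n)%N ==> P j (X Sm Sp k u n)]).
  apply: bigcapT_measurable => j; apply: bigcupT_measurable => N.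
  apply: bigcapT_measurable => n.
  exact: (measurable_X_set Sm Sp k n (fun x => (N <= n)%N ==> P j x)).
apply/seteqP; split=> u /=.
  by move=> h j _; have [N hN] := h j; exists N => // n _ /=; apply/implyP/hN.
move=> h j; have [N _ hN] := h j I; exists N => n Nn.
by have /implyP := hN n I; exact.
Qed.

Lemma measurable_Eminus Sm Sp k : measurable [set u | Eminus (X Sm Sp k u)].
Proof.
rewrite (_ : [set u | _] = [set u | forall j, exists N, forall n, (N <= n)%N ->
    (fun j x => x < - j%:Z) j (X Sm Sp k u n)]).
  exact: (measurable_eventually (fun j x => x < - j%:Z)).
by apply/seteqP; split=> u /EminusP.
Qed.

Lemma measurable_Eplus Sm Sp k : measurable [set u | Eplus (X Sm Sp k u)].
Proof.
rewrite (_ : [set u | _] = [set u | forall j, exists N, forall n, (N <= n)%N ->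
    (fun j x => j%:Z < x) j (X Sm Sp k u n)]).
  exact: (measurable_eventually (fun j x => j%:Z < x)).
by apply/seteqP; split=> u /EplusP.
Qed.

Lemma measurable_asbool (A : set R) : measurable A ->
  measurable_fun [set: R] (fun u => `[< A u >]).
Proof.
move=> mA; apply: (measurable_fun_bool true).
rewrite setTI (_ : _ @^-1` _ = A)//.
by apply/seteqP; split=> u /=; [move/asboolP|move=> Au; apply/asboolP].
Qed.

Lemma measurable_terminal (lo hi star : R) Sm Sp k :
  measurable_fun [set: R] (fun u => terminal lo hi star (X Sm Sp k u)).
Proof.
apply: measurable_fun_ifT; [|exact: measurable_cst|].
  exact: (measurable_asbool (measurable_Eminus Sm Sp k)).
apply: measurable_fun_ifT; [|exact: measurable_cst|exact: measurable_cst].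
exact: (measurable_asbool (measurable_Eplus Sm Sp k)).
Qed.

Lemma total_stakeE S (x : nat -> int) : is_strategy S ->
  total_stake S x = (\sum_(0 <= t <oo) (S (x t) t.+1)%:E)%E.
Proof.
move=> hS; rewrite /total_stake -(@nneseries_addn _ _ 1%N).
  by under eq_eseriesr do rewrite addn1.
by move=> i; rewrite lee_fin.
Qed.

Lemma total_stake_ge0 S (x : nat -> int) : is_strategy S ->
  (0 <= total_stake S x)%E.
Proof. by move=> hS; apply: nneseries_ge0 => n _ _; rewrite lee_fin. Qed.

Lemma total_stake_cons S k (x : nat -> int) : is_strategy S ->
  total_stake S (path_cons k x) =
  ((S k 1%N)%:E + total_stake (shift_strategy S) x)%E.
Proof.
move=> hS; rewrite !total_stakeE//; last by move=> i t; exact: hS.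
rewrite (nneseries_split 0 1)//; last by move=> i _; rewrite lee_fin.
rewrite add0n big_nat1; congr (_ + _)%E.
rewrite -(@nneseries_addn _ _ 1%N); first by under eq_eseriesr do rewrite addn1.
by move=> i; rewrite lee_fin.
Qed.

Lemma measurable_total_stake S Sm Sp k : is_strategy S ->
  measurable_fun [set: R] (fun u => total_stake S (X Sm Sp k u)).
Proof.
move=> hS; under eq_fun do rewrite total_stakeE//.
apply: ge0_emeasurable_sum => [t u _ _|t _]; first by rewrite lee_fin.
apply/measurable_EFinP; exact: (measurable_X Sm Sp k t (fun x => S x t.+1)).
Qed.

Lemma Eminus_cons k x : Eminus (path_cons k x) <-> Eminus x.
Proof.
split=> h M; have [N hN] := h M.
  by exists N => n Nn; apply: (hN n.+1); rewrite ltnW.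
by exists N.+1 => -[//|n] Nn; exact: hN.
Qed.

Lemma Eplus_cons k x : Eplus (path_cons k x) <-> Eplus x.
Proof.
split=> h M; have [N hN] := h M.
  by exists N => n Nn; apply: (hN n.+1); rewrite ltnW.
by exists N.+1 => -[//|n] Nn; exact: hN.
Qed.

Lemma terminal_cons (lo hi star : R) k x :
  terminal lo hi star (path_cons k x) = terminal lo hi star x.
Proof.
by rewrite /terminal (asbool_equiv_eq (Eminus_cons k x))
  (asbool_equiv_eq (Eplus_cons k x)).
Qed.

Lemma EminusNplus x : Eminus x -> ~ Eplus x.
Proof.
move=> /(_ 0)[N hN] /(_ 0)[M hM].
have := hN (maxn N M) (leq_maxl _ _); have := hM (maxn N M) (leq_maxr _ _); lia.
Qed.

End Walk.

(** * First-step equations *)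

Section Cost.
Context {R : realType}.
Local Notation mu := (@lebesgue_measure R).
Local Notation D01 := (`[0%R, 1%R]%classic : set R).
Implicit Types (S Sm Sp : strategy R) (k : int) (u : R).
Local Open Scope ereal_scope.

Lemma mu01 : mu D01 = 1.
Proof. by rewrite lebesgue_measure_itv/= lte_fin ltr01 sube0. Qed.

Lemma integral01_cst (r : \bar R) : \int[mu]_(u in D01) r = r.
Proof. by rewrite integral_cst//= mu01 mule1. Qed.

Lemma integral01_cstD (r : R) (f : R -> \bar R) : (0 <= r)%R ->
  measurable_fun D01 f -> (forall u, 0 <= f u) ->
  \int[mu]_(u in D01) (r%:E + f u) = r%:E + \int[mu]_(u in D01) f u.
Proof. by move=> r0 mf f0; rewrite ge0_integralD//= integral01_cst. Qed.

Lemma integrable01_cst (r : R) : mu.-integrable D01 (fun=> r%:E).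
Proof.
apply/integrableP; split=> //=.
by rewrite integral01_cst ltry.
Qed.

(** Expected payoffs may be [-oo], so linearity settles only the case of finite integral. Otherwise
    both sides are [-oo]: the positive part of [K - g] is at most [|K|], and the negative part
    carries the infinite mass. *)
Lemma integral01_cstB (K : R) (g : R -> \bar R) :
  measurable_fun D01 g -> (forall u, 0 <= g u) ->
  \int[mu]_(u in D01) (K%:E - g u) = K%:E - \int[mu]_(u in D01) g u.
Proof.
move=> mg g0; have [gfin|] := ltP (\int[mu]_(u in D01) g u) +oo.
  rewrite (@integralB _ _ _ mu _ _ (fun=> K%:E)) ?integral01_cst//.
    exact: integrable01_cst.
  by apply/integrableP; split => //; under eq_integral do rewrite gee0_abs//.
rewrite leye_eq => /eqP gy; rewrite gy /= integralE.
set f := fun u => K%:E - g u.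
have mf : measurable_fun D01 f.
  apply: emeasurable_funB => //; exact: measurable_cst.
have fpos : \int[mu]_(x in D01) f^\+ x \is a fin_num.
  rewrite ge0_fin_numE; last by apply: integral_ge0.
  apply: (@le_lt_trans _ _ (\int[mu]_(x in D01) `|K|%:E)); last first.
    by rewrite integral01_cst ltry.
  apply: ge0_le_integral => //; first exact: measurable_funepos.
  move=> x _; rewrite /f funeposE ge_max lee_fin normr_ge0 andbT.
  case: (g x) (g0 x) => [r| |]//; last by rewrite leNye.
  by rewrite -EFinB !lee_fin => r0; have := ler_norm K; lra.
have fneg : \int[mu]_(x in D01) f^\- x = +oo.
  apply/eqP; rewrite -leye_eq.
  (* Pointwise [g <= |K| + f^-], so the infinite integral of [g] passes to [f^-]. *)
  have : +oo <= \int[mu]_(x in D01) (`|K|%:E + f^\- x).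
    rewrite -gy; apply: ge0_le_integral => //.
      by apply: emeasurable_funD => //; exact: measurable_funeneg.
    move=> x _; apply: (@le_trans _ _ (`|K|%:E - f x)); last first.
      by rewrite leeD2l// funenegE le_max lexx.
    rewrite /f; case: (g x) (g0 x) => [r| |]//= _.
    by rewrite lee_fin; have := ler_norm K; lra.
  rewrite integral01_cstD//; last exact: measurable_funeneg.
  by rewrite addeC -leeBlDr.
by rewrite fneg; case: (\int[mu]_(x in D01) f^\+ x) fpos.
Qed.

(** The rescalings need a branch of positive length; when [p] is 0 or 1 the degenerate branch has
    weight zero instead. On the up branch the endpoint [u = 1] is dropped as a null set. *)
Lemma integral_first_step (F : (nat -> int) -> \bar R) Sm Sp k
    (Sm' := shift_strategy Sm) (Sp' := shift_strategy Sp)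
    (p := pup Sm Sp k 1) : is_strategy Sm -> is_strategy Sp ->
  (forall x, 0 <= F x) ->
  measurable_fun setT (fun u => F (X Sm Sp k u)) ->
  (forall j, measurable_fun setT (fun u => F (path_cons k (X Sm' Sp' j u)))) ->
  \int[mu]_(u in D01) F (X Sm Sp k u) =
  p%:E * \int[mu]_(u in D01) F (path_cons k (X Sm' Sp' (k + 1) u)) +
  (1 - p)%:E * \int[mu]_(u in D01) F (path_cons k (X Sm' Sp' (k - 1) u)).
Proof.
move=> hm hp F0 mF mF'; have p01 := pup_ge0_le1 k 1 hm hp; rewrite -/p in p01.
have /andP[p0 p1] := p01.
rewrite (ge0_integral_split01 p01)//; congr (_ + _).
  move: p0; rewrite le_eqVlt => /predU1P[<-|p0]; first by rewrite !mul0e.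
  congr (_ * _); rewrite -integral_itv_bndo_bndc; last first.
    apply: measurable_funTS; apply: (measurableT_comp mF).
    exact: measurable_funM.
  rewrite -[RHS]integral_itv_bndo_bndc; last exact: measurable_funTS.
  apply: eq_integral => u; rewrite inE/= in_itv/= => /andP[_ u1].
  by rewrite X_up.
move: p1; rewrite le_eqVlt => /predU1P[->|p1]; first by rewrite subrr !mul0e.
congr (_ * _); apply: eq_integral => u; rewrite inE/= in_itv/= => /andP[u0 _].
by rewrite X_down.
Qed.

(** * Expected costs and their first-step equation *)

Definition run_cost (lo hi star K : R) S (x : nat -> int) : \bar R :=
  total_stake S x + (K - terminal lo hi star x)%:E.

Definition cost (lo hi star K : R) S Sm Sp k : \bar R :=
  \int[mu]_(u in D01) run_cost lo hi star K S (X Sm Sp k u).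

Lemma terminal_le (lo hi star K : R) x : (lo <= K)%R -> (hi <= K)%R ->
  (star <= K)%R -> (terminal lo hi star x <= K)%R.
Proof. by move=> l h s; rewrite /terminal; case: ifP => // _; case: ifP. Qed.

Lemma run_cost_ge0 (lo hi star K : R) S x : (lo <= K)%R -> (hi <= K)%R ->
  (star <= K)%R -> is_strategy S -> 0 <= run_cost lo hi star K S x.
Proof.
move=> l h s hS; apply: adde_ge0; first exact: total_stake_ge0.
by rewrite lee_fin subr_ge0 terminal_le.
Qed.

Lemma measurable_K_terminal (lo hi star K : R) Sm Sp k :
  measurable_fun [set: R] (fun u => (K - terminal lo hi star (X Sm Sp k u))%:E).
Proof.
apply/measurable_EFinP; apply: measurable_funB; first exact: measurable_cst.
exact: measurable_terminal.
Qed.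

Lemma measurable_run_cost (lo hi star K : R) S Sm Sp k : is_strategy S ->
  measurable_fun [set: R] (fun u => run_cost lo hi star K S (X Sm Sp k u)).
Proof.
move=> hS; apply: emeasurable_funD; first exact: measurable_total_stake.
exact: measurable_K_terminal.
Qed.

Lemma payoffE (lo hi star K : R) S x : - total_stake S x + (terminal lo hi star x)%:E
  = K%:E - run_cost lo hi star K S x.
Proof.
rewrite /run_cost; case: (total_stake S x) => [r||]//=.
by congr (_%:E); ring.
Qed.

Lemma integral_payoffE (lo hi star K : R) S Sm Sp k : (lo <= K)%R -> (hi <= K)%R ->
  (star <= K)%R -> is_strategy S ->
  \int[mu]_(u in D01) (- total_stake S (X Sm Sp k u) +
     (terminal lo hi star (X Sm Sp k u))%:E) =
  K%:E - cost lo hi star K S Sm Sp k.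
Proof.
move=> l h s hS; under eq_integral do rewrite (payoffE _ _ _ K).
rewrite integral01_cstB//.
  by apply: measurable_funTS; exact: measurable_run_cost.
by move=> u; exact: run_cost_ge0.
Qed.

Lemma run_cost_cons (lo hi star K : R) S k x : is_strategy S ->
  run_cost lo hi star K S (path_cons k x) =
  (S k 1%N)%:E + run_cost lo hi star K (shift_strategy S) x.
Proof. by move=> hS; rewrite /run_cost total_stake_cons// terminal_cons addeA. Qed.

Lemma is_strategy_shift S : is_strategy S -> is_strategy (shift_strategy S).
Proof. by move=> hS i t; exact: hS. Qed.

Lemma cost_ge0 (lo hi star K : R) S Sm Sp k : (lo <= K)%R -> (hi <= K)%R ->
  (star <= K)%R -> is_strategy S -> 0 <= cost lo hi star K S Sm Sp k.
Proof. by move=> l h s hS; apply: integral_ge0 => u _; exact: run_cost_ge0. Qed.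

Lemma average_cstD (p s : R) (x y : \bar R) : (0 <= p <= 1)%R -> 0 <= x -> 0 <= y ->
  p%:E * (s%:E + x) + (1 - p)%:E * (s%:E + y) = s%:E + (p%:E * x + (1 - p)%:E * y).
Proof.
move=> /andP[p0 p1] x0 y0.
rewrite !muleDr ?fin_num_adde_defr// addeACA -!EFinM -EFinD; congr (_%:E + _).
by ring.
Qed.

Lemma cost_first_step (lo hi star K : R) S Sm Sp k (S' := shift_strategy S)
    (Sm' := shift_strategy Sm) (Sp' := shift_strategy Sp) (p := pup Sm Sp k 1) :
  (lo <= K)%R -> (hi <= K)%R -> (star <= K)%R ->
  is_strategy S -> is_strategy Sm -> is_strategy Sp ->
  cost lo hi star K S Sm Sp k = (S k 1%N)%:E +
    (p%:E * cost lo hi star K S' Sm' Sp' (k + 1) +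
     (1 - p)%:E * cost lo hi star K S' Sm' Sp' (k - 1)).
Proof.
move=> l h s hS hm hp.
have hS' := is_strategy_shift hS; rewrite -/S' in hS'.
have mS' j := measurable_run_cost lo hi star K Sm' Sp' j hS'.
have S'0 x := run_cost_ge0 x l h s hS'.
rewrite /cost integral_first_step//.
- under eq_integral do rewrite run_cost_cons//.
  under [X in _ + _ * X]eq_integral do rewrite run_cost_cons//.
  rewrite !integral01_cstD//; try exact: measurable_funTS.
  rewrite average_cstD//; [exact: pup_ge0_le1|exact: integral_ge0..].
- by move=> x; exact: run_cost_ge0.
- exact: measurable_run_cost.
- move=> j; under eq_fun do rewrite run_cost_cons//.
  by apply: emeasurable_funD => //; exact: measurable_cst.
Qed.

(** * Costs up to a finite horizon *)

Definition partial_stake S (x : nat -> int) n : R :=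
  (\sum_(0 <= t < n) S (x t) t.+1)%R.

Lemma partial_stake_ge0 S x n : is_strategy S -> (0 <= partial_stake S x n)%R.
Proof. by move=> hS; apply: sumr_ge0. Qed.

Lemma partial_stake_cons S k x n : partial_stake S (path_cons k x) n.+1 =
  (S k 1%N + partial_stake (shift_strategy S) x n)%R.
Proof. by rewrite /partial_stake big_nat_recl. Qed.

Lemma measurable_partial_stake S Sm Sp k n :
  measurable_fun [set: R] (fun u => partial_stake S (X Sm Sp k u) n).
Proof.
apply: measurable_sum => t.
exact: (measurable_X Sm Sp k t (fun x => S x t.+1)).
Qed.

(** Here [w] stands for the residual cost after time [n]. It is applied with [w = K - v], so a
    supermartingale of payoffs appears as a submartingale of costs. *)
Definition horizon_cost (w : int -> R) S Sm Sp k n : \bar R :=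
  \int[mu]_(u in D01)
    (partial_stake S (X Sm Sp k u) n + w (X Sm Sp k u n))%:E.

Lemma measurable_horizon (w : int -> R) S Sm Sp k n : measurable_fun [set: R]
  (fun u => (partial_stake S (X Sm Sp k u) n + w (X Sm Sp k u n))%:E).
Proof.
apply/measurable_EFinP; apply: measurable_funD.
  exact: measurable_partial_stake.
exact: measurable_X.
Qed.

Lemma horizon_cost0 w S Sm Sp k : horizon_cost w S Sm Sp k 0 = (w k)%:E.
Proof.
rewrite /horizon_cost /partial_stake /X/=.
by under eq_integral do rewrite big_nil add0r; rewrite integral01_cst.
Qed.

Lemma horizon_costS w S Sm Sp k n (S' := shift_strategy S)
    (Sm' := shift_strategy Sm) (Sp' := shift_strategy Sp) (p := pup Sm Sp k 1) :
  (forall x, 0 <= w x)%R -> is_strategy S -> is_strategy Sm -> is_strategy Sp ->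
  horizon_cost w S Sm Sp k n.+1 = (S k 1%N)%:E +
    (p%:E * horizon_cost w S' Sm' Sp' (k + 1) n +
     (1 - p)%:E * horizon_cost w S' Sm' Sp' (k - 1) n).
Proof.
move=> w0 hS hm hp; have hS' := is_strategy_shift hS; rewrite -/S' in hS'.
have mS' j := measurable_horizon w S' Sm' Sp' j n.
have S'0 (x : nat -> int) : 0 <= (partial_stake S' x n + w (x n))%:E.
  by rewrite lee_fin addr_ge0// partial_stake_ge0.
pose F (x : nat -> int) := (partial_stake S x n.+1 + w (x n.+1))%:E.
have FE x : F (path_cons k x) = (S k 1%N)%:E + (partial_stake S' x n + w (x n))%:E.
  by rewrite /F partial_stake_cons/= -EFinD addrA.
rewrite /horizon_cost (@integral_first_step F)//.
- under eq_integral do rewrite FE.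
  under [X in _ + _ * X]eq_integral do rewrite FE.
  rewrite !integral01_cstD//; try exact: measurable_funTS.
  by rewrite average_cstD//; [exact: pup_ge0_le1|exact: integral_ge0..].
- by move=> x; rewrite lee_fin addr_ge0// partial_stake_ge0.
- exact: measurable_horizon.
- move=> j; under eq_fun do rewrite FE.
  by apply: emeasurable_funD => //; exact: measurable_cst.
Qed.

(** Induction on the horizon with all strategies shifted by one turn: the first-step equation takes
    the place of conditional expectations in the submartingale inequality. *)
Lemma horizon_cost_ge (w : int -> R) S Sm Sp k n : (forall x, 0 <= w x)%R ->
  is_strategy S -> is_strategy Sm -> is_strategy Sp ->
  (forall x t, w x <= S x t.+1 + (pup Sm Sp x t.+1 * w (x + 1) +
                  (1 - pup Sm Sp x t.+1) * w (x - 1)))%R ->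
  (w k)%:E <= horizon_cost w S Sm Sp k n.
Proof.
move=> w0; elim: n S Sm Sp k => [|n IH] S Sm Sp k hS hm hp hw.
  by rewrite horizon_cost0.
rewrite horizon_costS//; have := hw k 0%N; rewrite -lee_fin => /le_trans; apply.
have /andP[p0 p1] := pup_ge0_le1 k 1 hm hp.
have h j : (w j)%:E <= horizon_cost w (shift_strategy S) (shift_strategy Sm)
    (shift_strategy Sp) j n.
  apply: IH; [exact: is_strategy_shift..|].
  by move=> x t; exact: (hw x t.+1).
rewrite !EFinD !EFinM leeD2l// leeD//.
  by rewrite lee_wpmul2l.
by rewrite lee_wpmul2l ?lee_fin ?subr_ge0.
Qed.

Lemma horizon_cost_le (w : int -> R) S Sm Sp k n : (forall x, 0 <= w x)%R ->
  is_strategy S -> is_strategy Sm -> is_strategy Sp ->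
  (forall x t, S x t.+1 + (pup Sm Sp x t.+1 * w (x + 1) +
                  (1 - pup Sm Sp x t.+1) * w (x - 1)) <= w x)%R ->
  horizon_cost w S Sm Sp k n <= (w k)%:E.
Proof.
move=> w0; elim: n S Sm Sp k => [|n IH] S Sm Sp k hS hm hp hw.
  by rewrite horizon_cost0.
rewrite horizon_costS//; have hk := hw k 0%N; rewrite -lee_fin in hk.
apply: le_trans hk.
have /andP[p0 p1] := pup_ge0_le1 k 1 hm hp.
have h j : horizon_cost w (shift_strategy S) (shift_strategy Sm)
    (shift_strategy Sp) j n <= (w j)%:E.
  apply: IH; [exact: is_strategy_shift..|].
  by move=> x t; exact: (hw x t.+1).
rewrite !EFinD !EFinM leeD2l// leeD//.
  by rewrite lee_wpmul2l.
by rewrite lee_wpmul2l ?lee_fin ?subr_ge0.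
Qed.

End Cost.

(** * Infinite horizon *)

Section Limits.
Context {R : realType}.
Local Notation mu := (@lebesgue_measure R).
Local Notation D01 := (`[0%R, 1%R]%classic : set R).
Implicit Types (S Sm Sp : strategy R) (k : int) (u : R).

Definition escapes (x : nat -> int) := Eminus x \/ Eplus x.

Lemma cvg_Eplus (w : int -> R) (l : R) x : (fun n : nat => w n%:Z) @ \oo --> l ->
  Eplus x -> (fun n => w (x n)) @ \oo --> l.
Proof.
move=> /cvgrPdist_lt h Ex; apply/cvgrPdist_lt => e /h[N _ hN].
have [M hM] := Ex N%:Z; exists M => // n /= /hM Nx.
have -> : x n = `|x n|%N%:Z by lia.
by apply: hN => /=; lia.
Qed.

Lemma cvg_Eminus (w : int -> R) (l : R) x :
  (fun n : nat => w (- n%:Z)) @ \oo --> l ->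
  Eminus x -> (fun n => w (x n)) @ \oo --> l.
Proof.
move=> /cvgrPdist_lt h Ex; apply/cvgrPdist_lt => e /h[N _ hN].
have [M hM] := Ex (- N%:Z); exists M => // n /= /hM Nx.
have -> : x n = - `|x n|%N%:Z by lia.
by apply: hN => /=; lia.
Qed.

(* On non-escaping paths the tail value is frozen at its upper bound, so that
   it converges along every path. *)
Definition tail_value (w : int -> R) (c : R) (x : nat -> int) n : R :=
  if `[< Eminus x >] then w (x n) else if `[< Eplus x >] then w (x n) else c.

Lemma tail_value_escapes w c x n : escapes x -> tail_value w c x n = w (x n).
Proof.
rewrite /tail_value; case: asboolP => // h [//|Ep].
by case: asboolP.
Qed.

Lemma measurable_tail_value w c Sm Sp k n :
  measurable_fun [set: R] (fun u => tail_value w c (X Sm Sp k u) n).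
Proof.
apply: measurable_fun_ifT; [|exact: measurable_X|].
  exact: (measurable_asbool (measurable_Eminus Sm Sp k)).
apply: measurable_fun_ifT; [|exact: measurable_X|exact: measurable_cst].
exact: (measurable_asbool (measurable_Eplus Sm Sp k)).
Qed.

Lemma tail_value_cvg (w : int -> R) (lo hi star K : R) x :
  (fun n : nat => w (- n%:Z)) @ \oo --> K - lo ->
  (fun n : nat => w n%:Z) @ \oo --> K - hi ->
  tail_value w (K - star) x @ \oo --> K - terminal lo hi star x.
Proof.
move=> wlo whi; rewrite /tail_value /terminal; case: asboolP => [Em|_].
  exact: cvg_Eminus.
by case: asboolP => [Ep|_]; [exact: cvg_Eplus|exact: cvg_cst].
Qed.

Local Open Scope ereal_scope.

Lemma integral_tail_value_cvg (w : int -> R) (lo hi star K : R) Sm Sp k :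
  (forall x, 0 <= w x <= K - star)%R ->
  ((fun n : nat => w (- n%:Z)%R) @ \oo --> (K - lo)%R) ->
  ((fun n : nat => w n%:Z) @ \oo --> (K - hi)%R) ->
  \int[mu]_(u in D01) (tail_value w (K - star) (X Sm Sp k u) n)%:E @[n --> \oo]
  --> \int[mu]_(u in D01) (K - terminal lo hi star (X Sm Sp k u))%:E.
Proof.
move=> w0 wlo whi.
have B0 : (0 <= K - star)%R by have /andP[] := w0 0%R; exact: le_trans.
have [] := @dominated_convergence _ _ _ mu D01 _
  (fun n u => (tail_value w (K - star) (X Sm Sp k u) n)%:E)
  (fun u => (K - terminal lo hi star (X Sm Sp k u))%:E) (fun=> (K - star)%:E).
- by [].
- move=> n; apply: measurable_funTS; apply/measurable_EFinP.
  exact: measurable_tail_value.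
- by apply: measurable_funTS; exact: measurable_K_terminal.
- apply: aeW => u _; apply: cvg_EFin; first exact: nearW.
  exact: tail_value_cvg.
- exact: integrable01_cst.
- apply: aeW => u n _; rewrite lee_fin ger0_norm /tail_value.
    by case: ifP => _; [|case: ifP => // _]; have /andP[] := w0 (X Sm Sp k u n).
  by case: ifP => _; [|case: ifP => // _]; have /andP[] := w0 (X Sm Sp k u n).
- by [].
Qed.

Lemma costE (lo hi star K : R) S Sm Sp k : (lo <= K)%R -> (hi <= K)%R ->
  (star <= K)%R -> is_strategy S ->
  cost lo hi star K S Sm Sp k =
  \int[mu]_(u in D01) total_stake S (X Sm Sp k u) +
  \int[mu]_(u in D01) (K - terminal lo hi star (X Sm Sp k u))%:E.
Proof.
move=> l h s hS; rewrite /cost /run_cost ge0_integralD//.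
- by move=> u _; exact: total_stake_ge0.
- by apply: measurable_funTS; exact: measurable_total_stake.
- by move=> u _; rewrite lee_fin subr_ge0 terminal_le.
- by apply: measurable_funTS; exact: measurable_K_terminal.
Qed.

Lemma partial_stakeE S x n : is_strategy S ->
  (partial_stake S x n)%:E <= total_stake S x.
Proof.
move=> hS; rewrite total_stakeE// /partial_stake -sumEFin.
by apply: nneseries_lim_ge => t _ _; rewrite lee_fin.
Qed.

Lemma partial_stake_cvg S x : is_strategy S ->
  limn (fun n => (partial_stake S x n)%:E) = total_stake S x.
Proof.
move=> hS; rewrite total_stakeE//; congr (limn _); apply/funext => n.
by rewrite sumEFin.
Qed.

Lemma integral_partial_stake_cvg S Sm Sp k : is_strategy S ->
  \int[mu]_(u in D01) (partial_stake S (X Sm Sp k u) n)%:E @[n --> \oo]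
  --> \int[mu]_(u in D01) total_stake S (X Sm Sp k u).
Proof.
move=> hS; rewrite (_ : \int[mu]_(u in D01) total_stake S (X Sm Sp k u) =
  \int[mu]_(u in D01) limn (fun n => (partial_stake S (X Sm Sp k u) n)%:E)).
  apply: (@cvg_monotone_convergence _ _ _ mu D01 _
    (fun n u => (partial_stake S (X Sm Sp k u) n)%:E)) => //.
  - move=> n; apply: measurable_funTS; apply/measurable_EFinP.
    exact: measurable_partial_stake.
  - by move=> n u _; rewrite lee_fin partial_stake_ge0.
  - move=> u _ m n mn; rewrite lee_fin /partial_stake.
    by rewrite (big_cat_nat (n := m) _ mn)//= lerDl sumr_ge0.
by apply: eq_integral => u _; rewrite partial_stake_cvg.
Qed.

(** Replacing [w (X_n)] by the tail value and the partial stake by the total one can only raise the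
    finite-horizon cost, since [w <= K - star]. The lower bound therefore survives the limit whether
    or not the walk escapes. *)
Lemma subsolution_le_cost (w : int -> R) (lo hi star K : R) S Sm Sp k :
  (lo <= K)%R -> (hi <= K)%R -> (star <= K)%R ->
  is_strategy S -> is_strategy Sm -> is_strategy Sp ->
  (forall x, 0 <= w x <= K - star)%R ->
  ((fun n : nat => w (- n%:Z)%R) @ \oo --> (K - lo)%R) ->
  ((fun n : nat => w n%:Z) @ \oo --> (K - hi)%R) ->
  (forall x t, w x <= S x t.+1 + (pup Sm Sp x t.+1 * w (x + 1)%R +
                  (1 - pup Sm Sp x t.+1) * w (x - 1)%R))%R ->
  (w k)%:E <= cost lo hi star K S Sm Sp k.
Proof.
move=> l h s hS hm hp w0 wlo whi hw; rewrite costE//.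
have w_ge0 x : (0 <= w x)%R by have /andP[] := w0 x.
have tv0 u n : (0 <= tail_value w (K - star) (X Sm Sp k u) n)%R.
  by rewrite /tail_value; case: ifP => // _; case: ifP => // _; rewrite subr_ge0.
have cv := @integral_tail_value_cvg w lo hi star K Sm Sp k w0 wlo whi.
apply: (@cvge_ge _ \oo _ _ (fun n => \int[mu]_(u in D01) total_stake S (X Sm Sp k u) +
   \int[mu]_(u in D01) (tail_value w (K - star) (X Sm Sp k u) n)%:E)); last first.
  apply: cvgeD cv; last exact: cvg_cst.
  apply: ge0_adde_def; rewrite inE.
    by apply: integral_ge0 => u _; exact: total_stake_ge0.
  by apply: integral_ge0 => u _; rewrite lee_fin subr_ge0 terminal_le.
apply: nearW => n; apply: (le_trans (horizon_cost_ge k n w_ge0 hS hm hp hw)).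
rewrite -ge0_integralD//.
- apply: ge0_le_integral => //.
  + by move=> u _; rewrite lee_fin addr_ge0// partial_stake_ge0.
  + by apply: measurable_funTS; exact: measurable_horizon.
  + apply: emeasurable_funD.
      by apply: measurable_funTS; exact: measurable_total_stake.
    by apply: measurable_funTS; apply/measurable_EFinP; exact: measurable_tail_value.
  + move=> u _; rewrite EFinD leeD ?partial_stakeE// lee_fin /tail_value.
    by case: ifP => // _; case: ifP => // _; have /andP[] := w0 (X Sm Sp k u n).
- by move=> u _; exact: total_stake_ge0.
- by apply: measurable_funTS; exact: measurable_total_stake.
- by move=> u _; rewrite lee_fin.
- by apply: measurable_funTS; apply/measurable_EFinP; exact: measurable_tail_value.
Qed.

Lemma horizon_costE (w : int -> R) S Sm Sp k n : (forall x, 0 <= w x)%R ->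
  is_strategy S -> horizon_cost w S Sm Sp k n =
  \int[mu]_(u in D01) (partial_stake S (X Sm Sp k u) n)%:E +
  \int[mu]_(u in D01) (w (X Sm Sp k u n))%:E.
Proof.
move=> w0 hS; rewrite /horizon_cost -ge0_integralD//.
- by move=> u _; rewrite lee_fin partial_stake_ge0.
- apply: measurable_funTS; apply/measurable_EFinP; exact: measurable_partial_stake.
- by move=> u _; rewrite lee_fin.
- apply: measurable_funTS; apply/measurable_EFinP; exact: measurable_X.
Qed.

(** Dropping the nonnegative term [w (X_n)] from the finite-horizon bound leaves the expected stakes
    up to time [n], which increase to the expected total stake. *)
Lemma integral_total_stake_le (w : int -> R) S Sm Sp k :
  is_strategy S -> is_strategy Sm -> is_strategy Sp ->
  (forall x, 0 <= w x)%R ->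
  (forall x t, S x t.+1 + (pup Sm Sp x t.+1 * w (x + 1)%R +
                  (1 - pup Sm Sp x t.+1) * w (x - 1)%R) <= w x)%R ->
  \int[mu]_(u in D01) total_stake S (X Sm Sp k u) <= (w k)%:E.
Proof.
move=> hS hm hp w0 hw; apply: cvge_le (@integral_partial_stake_cvg S Sm Sp k hS).
apply: nearW => n; apply: le_trans (horizon_cost_le k n w0 hS hm hp hw).
rewrite horizon_costE// leeDl//; apply: integral_ge0 => u _.
by rewrite lee_fin.
Qed.

(** For an upper bound the tail value errs on the wrong side; almost sure escape makes it coincide
    with [w (X_n)] up to a null set. *)
Lemma cost_le_supersolution (w : int -> R) (lo hi star K : R) S Sm Sp k :
  (lo <= K)%R -> (hi <= K)%R -> (star <= K)%R ->
  is_strategy S -> is_strategy Sm -> is_strategy Sp ->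
  (forall x, 0 <= w x <= K - star)%R ->
  ((fun n : nat => w (- n%:Z)%R) @ \oo --> (K - lo)%R) ->
  ((fun n : nat => w n%:Z) @ \oo --> (K - hi)%R) ->
  (forall x t, S x t.+1 + (pup Sm Sp x t.+1 * w (x + 1)%R +
                  (1 - pup Sm Sp x t.+1) * w (x - 1)%R) <= w x)%R ->
  {ae mu, forall u, D01 u -> escapes (X Sm Sp k u)} ->
  cost lo hi star K S Sm Sp k <= (w k)%:E.
Proof.
move=> l h s hS hm hp w0 wlo whi hw ae_esc; rewrite costE//.
have w_ge0 x : (0 <= w x)%R by have /andP[] := w0 x.
have tv0 u n : (0 <= tail_value w (K - star) (X Sm Sp k u) n)%R.
  by rewrite /tail_value; case: ifP => // _; case: ifP => // _; rewrite subr_ge0.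
have cv := @integral_tail_value_cvg w lo hi star K Sm Sp k w0 wlo whi.
apply: (@cvge_le _ \oo _ _ (fun n =>
   \int[mu]_(u in D01) (partial_stake S (X Sm Sp k u) n)%:E +
   \int[mu]_(u in D01) (tail_value w (K - star) (X Sm Sp k u) n)%:E)); last first.
  apply: cvgeD cv; last exact: integral_partial_stake_cvg.
  apply: ge0_adde_def; rewrite inE.
    by apply: integral_ge0 => u _; exact: total_stake_ge0.
  by apply: integral_ge0 => u _; rewrite lee_fin subr_ge0 terminal_le.
apply: nearW => n; apply: le_trans (horizon_cost_le k n w_ge0 hS hm hp hw).
rewrite horizon_costE// leeD2l//.
rewrite le_eqVlt; apply/orP; left; apply/eqP; apply: ae_eq_integral => //.
- by apply: measurable_funTS; apply/measurable_EFinP; exact: measurable_tail_value.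
- by apply: measurable_funTS; apply/measurable_EFinP; exact: measurable_X.
- move: ae_esc; apply: negligibleS; apply: subsetC => u hu Du.
  by rewrite tail_value_escapes//; exact: hu.
Qed.

(** Steps have size one, so a path that no longer visits 0 keeps its sign, and this sign tells to
    which end it escapes. *)
Lemma near_path_escapes (x : nat -> int) :
  (forall t, x t.+1 = x t + 1 \/ x t.+1 = x t - 1)%R ->
  (forall M : nat, exists N, forall n, (N <= n)%N -> (M < `|x n|)%N) -> escapes x.
Proof.
move=> xS xM; have [N0 hN0] := xM 0%N.
have [x0|x0] := lerP 0%R (x N0).
  right => M; have [N hN] := xM `|M|%N.
  have pos n : (0 < x (N0 + n)%N)%R.
    elim: n => [|n IH]; first by rewrite addn0; have := hN0 _ (leqnn N0); lia.
    have := hN0 (N0 + n.+1)%N (leq_addr _ _); rewrite addnS.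
    by case: (xS (N0 + n)%N) => ->; lia.
  exists (maxn N0 N) => n; rewrite geq_max => /andP[N0n Nn].
  by have := pos (n - N0)%N; rewrite subnKC// => ?; have := hN _ Nn; lia.
left => M; have [N hN] := xM `|M|%N.
have neg n : (x (N0 + n)%N < 0)%R.
  elim: n => [|n IH]; first by rewrite addn0.
  have := hN0 (N0 + n.+1)%N (leq_addr _ _); rewrite addnS.
  by case: (xS (N0 + n)%N) => ->; lia.
exists (maxn N0 N) => n; rewrite geq_max => /andP[N0n Nn].
by have := neg (n - N0)%N; rewrite subnKC// => ?; have := hN _ Nn; lia.
Qed.

(** On a finite window [|i| <= M] the stakes are bounded below by some [d > 0]; each visit costs at
    least [d], which a convergent series allows only finitely often. *)
Lemma finite_stake_escapes (c : int -> R) (x : nat -> int) :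
  (forall i, 0 < c i)%R -> (forall t, x t.+1 = x t + 1 \/ x t.+1 = x t - 1)%R ->
  total_stake (time_invariant c) x \is a fin_num -> escapes x.
Proof.
move=> c0 xS fx; apply: near_path_escapes => // M.
have hc : is_strategy (time_invariant c) by move=> i t; exact/ltW/c0.
have [d d0 hd] : exists2 d : R, (0 < d)%R &
    forall i, (`|i| <= M)%N -> (d <= c i)%R.
  elim: M => [|M [d d0 hd]].
    by exists (c 0%R) => // i i0; have -> : i = 0%R by lia.
  exists (Num.min d (Num.min (c M.+1%:Z) (c (- M.+1%:Z)%R))).
    by rewrite !lt_min d0 !c0.
  move=> i iM; rewrite !ge_min.
  have [/hd->//|iM'] := leqP `|i|%N M.
  have : i = M.+1%:Z \/ i = (- M.+1%:Z)%R by lia.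
  by case=> ->; rewrite lexx !orbT.
have tail : \sum_(N <= t <oo) (c (x t))%:E @[N --> \oo] --> 0.
  apply: nneseries_tail_cvg => [|t _]; last by rewrite lee_fin ltW.
  by move: fx; rewrite total_stakeE// => /fin_numP[_]; rewrite ltey.
have /fine_cvgP[[N1 _ hN1] /cvgrPdist_lt/(_ _ d0)[N2 _ hN2]] := tail.
exists (maxn N1 N2) => n; rewrite geq_max => /andP[N1n N2n].
rewrite ltnNge; apply/negP => /hd dx.
have := hN2 _ N2n; rewrite /= sub0r normrN => /ltr_normlW; apply/negP.
rewrite -leNgt (le_trans dx)// -lee_fin fineK; last exact: hN1.
(* The tail of the series from [n] on dominates its first term [c (x n)]. *)
apply: le_trans (@nneseries_lim_ge _ _ xpredT n n.+1 _).
  by rewrite big_nat1.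
by move=> t _ _; rewrite lee_fin ltW.
Qed.

Lemma ae_escapes (c : int -> R) Sm Sp k : (forall i, 0 < c i)%R ->
  \int[mu]_(u in D01) total_stake (time_invariant c) (X Sm Sp k u) < +oo ->
  {ae mu, forall u, D01 u -> escapes (X Sm Sp k u)}.
Proof.
move=> c0 fin.
have hc : is_strategy (time_invariant c) by move=> i t; exact/ltW/c0.
have int_stake : mu.-integrable D01 (fun u => total_stake (time_invariant c) (X Sm Sp k u)).
  apply/integrableP; split.
    by apply: measurable_funTS; exact: measurable_total_stake.
  by under eq_integral do rewrite gee0_abs ?total_stake_ge0//.
move/integrable_ae : int_stake => /(_ (measurable_itv _)).
apply: negligibleS; apply: subsetC => u h Du.
by apply: (@finite_stake_escapes c) (h Du) => // t; exact: X_step.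
Qed.

End Limits.

(** * From ABMN to Nash *)

Section ABMNAlgebra.
Context {R : realType}.
Implicit Types a b s m mp mm : R.

(** Eliminating [m] and [mp] leaves [a], [b] and [mm] as free variables, so that the inequalities
    below reduce to rational identities. *)
Lemma ABMN_solve a b m mp mm : 0 < a -> 0 < b ->
  (a + b) * (m + a) = a * mp + b * mm -> (a + b) ^+ 2 = b * (mp - mm) ->
  m = mm + a ^+ 2 / b /\ mp = mm + (a + b) ^+ 2 / b.
Proof.
move=> a0 b0 h1 h2; have b0' : b != 0 by rewrite gt_eqF.
have ab0 : a + b != 0 by rewrite gt_eqF// addr_gt0.
have mpE : mp = mm + (a + b) ^+ 2 / b by rewrite h2; field.
split=> //; apply: (mulfI ab0).
have -> : (a + b) * m = a * mp + b * mm - (a + b) * a by rewrite -h1; ring.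
by rewrite mpE; field.
Qed.

(** The loss from staking [s] instead of [a] is exactly [(a - s) ^+ 2 / (b + s)]. *)
Lemma ABMN_best_response a b m mp mm s : 0 < a -> 0 < b -> 0 <= s ->
  (a + b) * (m + a) = a * mp + b * mm -> (a + b) ^+ 2 = b * (mp - mm) ->
  s / (b + s) * mp + (1 - s / (b + s)) * mm - s <= m.
Proof.
move=> a0 b0 s0 h1 h2; have [-> ->] := ABMN_solve a0 b0 h1 h2.
have bs0 : 0 < b + s by rewrite ltr_wpDr.
rewrite -subr_ge0 (_ : _ - _ = (a - s) ^+ 2 / (b + s)).
  by rewrite divr_ge0 ?sqr_ge0// ltW.
by field; rewrite !gt_eqF.
Qed.

Lemma ABMN_increasing a b m mp mm : 0 < a -> 0 < b ->
  (a + b) * (m + a) = a * mp + b * mm -> (a + b) ^+ 2 = b * (mp - mm) ->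
  mm < m < mp.
Proof.
move=> a0 b0 h1 h2; have [-> ->] := ABMN_solve a0 b0 h1 h2.
by rewrite ltrDl divr_gt0 ?exprn_gt0//= ltrD2l ltr_pM2r ?invr_gt0//
  ltrXn2r ?ltW// ?addr_gt0// ltrDl.
Qed.

Lemma ABMN_equality a b m mp mm : 0 < a -> 0 < b ->
  (a + b) * (m + a) = a * mp + b * mm ->
  a / (b + a) * mp + (1 - a / (b + a)) * mm - a = m.
Proof.
move=> a0 b0 h1; have ab0 : a + b != 0 by rewrite gt_eqF// addr_gt0.
apply: (mulfI ab0); have -> : (a + b) * m = a * mp + b * mm - (a + b) * a.
  by rewrite -h1; ring.
by field; rewrite addrC.
Qed.

Lemma nondecreasing_int (v : int -> R) : (forall i, v i <= v (i + 1)) ->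
  forall i j, i <= j -> v i <= v j.
Proof.
move=> vS i j ij; have -> : j = i + `|(j - i)%R|%N%:Z by lia.
elim: (`|(j - i)%R|)%N => [|n IH]; first by rewrite addr0.
apply: (le_trans IH); rewrite (_ : i + n.+1%:Z = (i + n%:Z) + 1)//; lia.
Qed.

Lemma nondecreasing_int_bounds (v : int -> R) lo hi :
  (forall i, v i <= v (i + 1)) ->
  (fun k : nat => v (- k%:Z)) @ \oo --> lo ->
  (fun k : nat => v k%:Z) @ \oo --> hi -> forall i, lo <= v i <= hi.
Proof.
move=> vS vlo vhi i; have mon := nondecreasing_int vS; apply/andP; split.
  apply: (cvgr_to_le vlo); exists `|i|%N => // n /= h; apply: mon; lia.
by apply: (cvgr_to_ge vhi); exists `|i|%N => // n /= h; apply: mon; lia.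
Qed.

End ABMNAlgebra.

(** * Optimality of the stakes of a positive ABMN solution *)

Section ABMNtoNash.
Context {R : realType}.

(** The opponent's positive stake excludes the [0/0] case even when a deviation stakes nothing. *)
Lemma pup_opponent_gt0 (Sm Sp : strategy R) x t : 0 <= Sp x t -> 0 < Sm x t ->
  pup Sm Sp x t = Sp x t / (Sm x t + Sp x t).
Proof. by move=> p0 m0; rewrite /pup gt_eqF// ltr_wpDr. Qed.

Lemma pup_gt0_opponent (Sm Sp : strategy R) x t : 0 < Sp x t -> 0 <= Sm x t ->
  pup Sm Sp x t = 1 - Sm x t / (Sp x t + Sm x t).
Proof.
move=> p0 m0; have s0 : Sp x t + Sm x t != 0 by rewrite gt_eqF// ltr_wpDr.
by rewrite /pup addrC (negbTE s0); field.
Qed.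

Lemma EplusE (mlo mhi ms K : R) (Sm Sp : strategy R) k : mlo <= K -> mhi <= K ->
  ms <= K -> is_strategy Sp ->
  (Eplus_payoff mlo mhi ms Sm Sp k = K%:E - cost mlo mhi ms K Sp Sm Sp k)%E.
Proof. by move=> *; exact: integral_payoffE. Qed.

Lemma EminusE (nlo nhi ns K : R) (Sm Sp : strategy R) k : nlo <= K -> nhi <= K ->
  ns <= K -> is_strategy Sm ->
  (Eminus_payoff nlo nhi ns Sm Sp k = K%:E - cost nlo nhi ns K Sm Sm Sp k)%E.
Proof. by move=> *; exact: integral_payoffE. Qed.

(* Optimality of a player whose value function is [v]: a deviation makes
   [v (X_t)] minus the past stakes a supermartingale, which is a martingale
   under the equilibrium pair. *)
Lemma verification (v c : int -> R) (lo hi star K : R) S Sm Sp Sm0 Sp0 k :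
  lo <= K -> hi <= K -> star <= lo -> star <= hi ->
  (forall i, 0 < c i) -> is_strategy S -> is_strategy Sm -> is_strategy Sp ->
  is_strategy Sm0 -> is_strategy Sp0 ->
  (forall x, star <= v x <= K) ->
  (fun n : nat => v (- n%:Z)) @ \oo --> lo ->
  (fun n : nat => v n%:Z) @ \oo --> hi ->
  (forall x t, pup Sm Sp x t.+1 * v (x + 1) +
    (1 - pup Sm Sp x t.+1) * v (x - 1) - S x t.+1 <= v x) ->
  (forall x t, pup Sm0 Sp0 x t.+1 * v (x + 1) +
    (1 - pup Sm0 Sp0 x t.+1) * v (x - 1) - c x = v x) ->
  (K%:E - cost lo hi star K S Sm Sp k <=
   K%:E - cost lo hi star K (time_invariant c) Sm0 Sp0 k)%E.
Proof.
move=> loK hiK slo shi c0 hS hm hp hm0 hp0 vb vlo vhi sup eqn.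
have sK := le_trans slo loK.
have hc : is_strategy (time_invariant c) by move=> i t; exact/ltW/c0.
pose w x := K - v x.
have wb x : 0 <= w x <= K - star by have := vb x; rewrite /w => /andP[]; lra.
have w0 x : 0 <= w x by have /andP[] := wb x.
have wlo : (fun n : nat => w (- n%:Z)) @ \oo --> K - lo.
  by apply: cvgB => //; exact: cvg_cst.
have whi : (fun n : nat => w n%:Z) @ \oo --> K - hi.
  by apply: cvgB => //; exact: cvg_cst.
have hw0 x t : c x + (pup Sm0 Sp0 x t.+1 * w (x + 1) +
    (1 - pup Sm0 Sp0 x t.+1) * w (x - 1)) <= w x.
  rewrite /w -[v x](eqn x t) le_eqVlt; apply/orP; left; apply/eqP; ring.
(* The value [w k] separates the two costs. At equilibrium the expected total stake is at most
   [w k], hence finite, which gives almost sure escape. *)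
apply: leeB => //; apply: (@le_trans _ _ (w k)%:E).
  apply: cost_le_supersolution => //; apply: (@ae_escapes _ c) => //.
  apply: (@le_lt_trans _ _ (w k)%:E); last exact: ltry.
  exact: integral_total_stake_le.
apply: subsolution_le_cost => // x t; rewrite /w.
by have := sup x t; set p := pup _ _ _ _; set A := v (x + 1);
  set B := v (x - 1) => ?; nra.
Qed.

Lemma ABMN_Nash (mlo mhi nlo nhi ms ns : R) (a b m n : int -> R) :
  mlo < mhi -> nhi < nlo -> ms <= mlo -> ns <= nhi ->
  positive_ABMN_bd a b m n mlo mhi nlo nhi ->
  Nash mlo mhi nlo nhi ms ns (time_invariant b) (time_invariant a).
Proof.
move=> mlh nhl msl nsh [H pos [mlo_cvg mhi_cvg nlo_cvg nhi_cvg]] S hS k.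
have a0 i : 0 < a i by have [] := pos i.
have b0 i : 0 < b i by have [] := pos i.
have ha : is_strategy (time_invariant a) by move=> i t; exact/ltW/a0.
have hb : is_strategy (time_invariant b) by move=> i t; exact/ltW/b0.
have H1 i : (a i + b i) * (m i + a i) = a i * m (i + 1) + b i * m (i - 1).
  by have [[]] := H i.
(* Mina's equations are Maxine's after exchanging [a] with [b], [m] with [n], and the two
   neighbouring sites; in this form the same algebraic lemmas serve both players. *)
have H2 i : (b i + a i) * (n i + b i) = b i * n (i - 1) + a i * n (i + 1).
  by have [_ []] := H i; rewrite addrC => -> *; rewrite addrC.
have H3 i : (a i + b i) ^+ 2 = b i * (m (i + 1) - m (i - 1)).
  by have [_ []] := H i.
have H4 i : (b i + a i) ^+ 2 = a i * (n (i - 1) - n (i + 1)).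
  by have [_ []] := H i; rewrite (addrC (b i)).
have mb : forall i, mlo <= m i <= mhi.
  apply: nondecreasing_int_bounds => // i.
  by have /andP[_ /ltW] := ABMN_increasing (a0 i) (b0 i) (H1 i) (H3 i).
have nb i : nhi <= n i <= nlo.
  have : - nlo <= - n i <= - nhi.
    apply: (@nondecreasing_int_bounds _ (fun i => - n i)).
    - move=> j; rewrite lerN2.
      by have /andP[/ltW] := ABMN_increasing (b0 j) (a0 j) (H2 j) (H4 j).
    - exact: cvgN.
    - exact: cvgN.
  by rewrite !lerN2 andbC.
split.
  rewrite !(@EplusE _ _ _ mhi)// ?(ltW mlh) ?(le_trans msl (ltW mlh))//.
  apply: (@verification m) => //; try lra.
  - by move=> x; have := mb x => /andP[]; lra.
  - move=> x t; rewrite pup_opponent_gt0//; last exact: b0.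
    exact: (ABMN_best_response (a0 x) (b0 x) (hS x t.+1) (H1 x) (H3 x)).
  - move=> x t; rewrite pup_opponent_gt0//; last exact: b0.
    exact: (ABMN_equality (a0 x) (b0 x) (H1 x)).
rewrite !(@EminusE _ _ _ nlo)// ?(ltW nhl) ?(le_trans nsh (ltW nhl))//.
apply: (@verification n) => //; try lra.
- by move=> x; have := nb x => /andP[]; lra.
- move=> x t; rewrite pup_gt0_opponent//; last exact: a0.
  have := ABMN_best_response (b0 x) (a0 x) (hS x t.+1) (H2 x) (H4 x).
  by set q := _ / _ => h; lra.
- move=> x t; rewrite pup_gt0_opponent//; last exact: a0.
  have := ABMN_equality (b0 x) (a0 x) (H2 x).
  by set q := _ / _ => h; lra.
Qed.

End ABMNtoNash.

(** * One-shot deviations *)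

Section BestResponse.
Context {R : realType}.
Local Notation mu := (@lebesgue_measure R).
Local Notation D01 := (`[0%R, 1%R]%classic : set R).
Implicit Types (own opp S : strategy R) (s : bool) (k : int).

(** The first argument is the player's own stake, whichever side that player is on, so one analysis
    covers both players. *)
Definition win (x d : R) : R := if d + x == 0 then 2^-1 else x / (d + x).

(* [s = true] is Maxine, who pushes the counter to the right. *)
Definition fwd s (k : int) : int := if s then k + 1 else k - 1.

Definition side_cost s (lo hi star K : R) own opp k : \bar R :=
  if s then cost lo hi star K own opp own k else cost lo hi star K own own opp k.

Lemma pup_win Sm Sp k t : pup Sm Sp k t = win (Sp k t) (Sm k t) :> R.
Proof. by []. Qed.

Lemma pup_win_opp Sm Sp k t : pup Sm Sp k t = 1 - win (Sm k t) (Sp k t) :> R.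
Proof.
rewrite /pup /win addrC; case: eqP => [_|/eqP s0]; first by field.
by field.
Qed.

Lemma eq_cost (lo hi star K : R) S S' Sm Sm' Sp Sp' k : is_strategy S ->
  is_strategy S' -> (forall i t, S i t.+1 = S' i t.+1) ->
  (forall i t, Sm i t.+1 = Sm' i t.+1) -> (forall i t, Sp i t.+1 = Sp' i t.+1) ->
  cost lo hi star K S Sm Sp k = cost lo hi star K S' Sm' Sp' k.
Proof.
move=> hS hS' e em ep; rewrite /cost /run_cost (eq_X k em ep).
apply: eq_integral => u _; rewrite !total_stakeE//.
by under eq_eseriesr do rewrite e.
Qed.

Lemma eq_side_cost s (lo hi star K : R) S S' d k : is_strategy S ->
  is_strategy S' -> (forall i t, S i t.+1 = S' i t.+1) ->
  side_cost s lo hi star K S d k = side_cost s lo hi star K S' d k.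
Proof. by move=> hS hS' e; case: s; exact: eq_cost. Qed.

Local Open Scope ereal_scope.

Lemma side_cost_first_step s (lo hi star K : R) own opp k
    (q := win (own k 1%N) (opp k 1%N)) (own' := shift_strategy own)
    (opp' := shift_strategy opp) :
  (lo <= K)%R -> (hi <= K)%R -> (star <= K)%R -> is_strategy own -> is_strategy opp ->
  side_cost s lo hi star K own opp k = (own k 1%N)%:E +
    (q%:E * side_cost s lo hi star K own' opp' (fwd s k) +
     (1 - q)%:E * side_cost s lo hi star K own' opp' (fwd (~~ s) k)).
Proof.
move=> l h st ho hp; case: s; rewrite /side_cost cost_first_step//.
by rewrite pup_win_opp -/q subKr [X in _ + X]addeC.
Qed.

(** * The value function when the stakes [c] are a best response to [d] *)

Section Equilibrium.
Variables (s : bool) (lo hi star K : R) (c d : int -> R).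
Hypotheses (loK : (lo <= K)%R) (hiK : (hi <= K)%R)
  (star_lo : (star <= lo)%R) (star_hi : (star <= hi)%R)
  (c0 : forall i, (0 <= c i)%R) (d0 : forall i, (0 <= d i)%R).
Local Notation C := (side_cost s lo hi star K).
Hypothesis best : forall S, is_strategy S -> forall k,
  C (time_invariant c) (time_invariant d) k <= C S (time_invariant d) k.

Let starK : (star <= K)%R. Proof. exact: le_trans star_lo loK. Qed.
Let hc : is_strategy (time_invariant c). Proof. by move=> i t; exact: c0. Qed.
Let hd : is_strategy (time_invariant d). Proof. by move=> i t; exact: d0. Qed.

Let C_ge0 S k : is_strategy S -> 0 <= C S (time_invariant d) k.
Proof. by move=> hS; rewrite /side_cost; case: s; exact: cost_ge0. Qed.

(** Never staking costs at most [K - star] whatever the terminal value, and a best response does no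
    worse. This makes the value finite. *)
Lemma equilibrium_cost_le k :
  C (time_invariant c) (time_invariant d) k <= (K - star)%:E.
Proof.
pose Z : strategy R := fun _ _ => 0%R.
have hZ : is_strategy Z by [].
have Z0 x : total_stake Z x = 0 by rewrite /total_stake eseries0.
apply: (le_trans (best hZ k)).
have h Sm Sp : cost lo hi star K Z Sm Sp k <= (K - star)%:E.
  rewrite /cost -[leRHS]integral01_cst.
  apply: ge0_le_integral => //.
  - by move=> u _; exact: run_cost_ge0.
  - by apply: measurable_funTS; exact: measurable_run_cost.
  - move=> u _; rewrite /run_cost Z0 add0e lee_fin lerD2l lerN2 /terminal.
    by case: ifP => // _; case: ifP.
by rewrite /side_cost; case: s.
Qed.

Definition eq_cost_value k := fine (C (time_invariant c) (time_invariant d) k).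
Local Notation w := eq_cost_value.

Lemma eq_cost_valueE k : C (time_invariant c) (time_invariant d) k = (w k)%:E.
Proof.
rewrite fineK// ge0_fin_numE; last exact: C_ge0.
by apply: (le_lt_trans (equilibrium_cost_le k)); exact: ltry.
Qed.

Lemma eq_cost_value_bounds k : (0 <= w k <= K - star)%R.
Proof.
by rewrite -!lee_fin -eq_cost_valueE equilibrium_cost_le C_ge0.
Qed.

Lemma eq_cost_value_step k :
  (w k = c k + (win (c k) (d k) * w (fwd s k) +
               (1 - win (c k) (d k)) * w (fwd (~~ s) k)))%R.
Proof.
apply: EFin_inj; rewrite -eq_cost_valueE side_cost_first_step//.
rewrite -[shift_strategy (time_invariant c)]/(time_invariant c).
rewrite -[shift_strategy (time_invariant d)]/(time_invariant d).
by rewrite !eq_cost_valueE.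
Qed.

Lemma eq_cost_value_deviation k x : (0 <= x)%R ->
  (w k <= x + (win x (d k) * w (fwd s k) +
               (1 - win x (d k)) * w (fwd (~~ s) k)))%R.
Proof.
(* Turns are numbered from 1, so only the first one is changed: after the shift, [S] differs from
   [c] at most at time 0, which the cost ignores. *)
move=> x0; pose S : strategy R := fun i t => if (t <= 1)%N then x else c i.
have hS : is_strategy S by move=> i t; rewrite /S; case: ifP.
rewrite -lee_fin -eq_cost_valueE (le_trans (best hS k))//.
rewrite side_cost_first_step//.
rewrite -[shift_strategy (time_invariant d)]/(time_invariant d).
have e j : C (shift_strategy S) (time_invariant d) j = (w j)%:E.
  by rewrite -eq_cost_valueE; apply: eq_side_cost => //; exact: is_strategy_shift.
by rewrite !e.
Qed.

(** The partial sums are [e - e / 2 ^+ n]. For [e > 0] such stakes are positive at every turn, yet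
    as cheap as desired. *)
Lemma geometric_stake_le (e : R) (x : nat -> int) : (0 <= e)%R ->
  total_stake (fun _ t => e / 2 ^+ t)%R x <= e%:E.
Proof.
move=> e0; have h : is_strategy (fun (_ : int) t => e / 2 ^+ t)%R.
  by move=> i t; rewrite divr_ge0// exprn_ge0.
rewrite -partial_stake_cvg//; apply: lime_le.
  apply: ereal_nondecreasing_is_cvgn => m n mn; rewrite lee_fin /partial_stake.
  by rewrite (big_cat_nat (n := m) _ mn)//= lerDl sumr_ge0// => t _; exact: (h 0%R).
apply: nearW => n; rewrite lee_fin.
have -> : partial_stake (fun _ t => e / 2 ^+ t)%R x n = (e - e / 2 ^+ n)%R.
  rewrite /partial_stake; elim: n => [|n IH]; first by rewrite big_nil expr0 divr1 subrr.
  rewrite big_nat_recr//= IH exprS; field.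
  by rewrite expf_neq0.
by rewrite lerBlDr lerDl divr_ge0// exprn_ge0.
Qed.

(* Against an opponent who never stakes, arbitrarily small stakes win every turn. *)
Lemma unopposed_cost k : (forall i, d i = 0%R) -> K = (if s then hi else lo) -> w k = 0%R.
Proof.
move=> dz KE; apply/eqP; rewrite eq_le; have /andP[-> _] := eq_cost_value_bounds k.
rewrite andbT; apply/ler_addgt0Pr => e e0; rewrite add0r -lee_fin -eq_cost_valueE.
pose S : strategy R := fun _ t => (e / 2 ^+ t)%R.
have S0 i t : (0 < S i t)%R by rewrite divr_gt0// exprn_gt0.
have hS : is_strategy S by move=> i t; exact: ltW.
apply: (le_trans (best hS k)); rewrite /side_cost.
have winE i t : win (S i t) (time_invariant d i t) = 1%R.
  by rewrite /win /time_invariant dz add0r gt_eqF// divff// gt_eqF.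
move: KE; case: s => KE.
  (* The up-probability is 1, so the cell stays [[0, 1)] and every [u < 1] moves right forever; the
     null point [u = 1] is discarded. *)
  rewrite /cost -integral_itv_bndo_bndc; last first.
    by apply: measurable_funTS; exact: measurable_run_cost.
  rewrite -[leRHS]integral01_cst -[leRHS]integral_itv_bndo_bndc//.
  apply: ge0_le_integral => //.
  - by move=> u _; exact: run_cost_ge0.
  - by apply: measurable_funTS; exact: measurable_run_cost.
  - move=> u /=; rewrite in_itv/= => /andP[_ u1].
    have XE t : X (time_invariant d) S k u t = (k + t%:Z)%R.
      suff : walk (time_invariant d) S k u t = ((k + t%:Z)%R, 0%R, 1%R).
        by rewrite /X => ->.
      elim: t => [|t /= ->]; first by rewrite /= addr0.
      rewrite pup_win winE mul1r subr0 add0r u1; congr (_, _, _).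
      by rewrite -addrA -[1%R]/(1%:Z) -PoszD addn1.
    have Ep : Eplus (X (time_invariant d) S k u).
      move=> M; exists (`|(M - k)%R|%N.+1) => n; rewrite XE; lia.
    rewrite /run_cost /terminal; case: asboolP => [/EminusNplus//|_].
    case: asboolP => // _; rewrite KE subrr adde0.
    exact/geometric_stake_le/ltW.
rewrite /cost -[leRHS]integral01_cst; apply: ge0_le_integral => //.
- by move=> u _; exact: run_cost_ge0.
- by apply: measurable_funTS; exact: measurable_run_cost.
- move=> u /=; rewrite in_itv/= => /andP[u0 _].
  have XE t : X S (time_invariant d) k u t = (k - t%:Z)%R.
    suff : walk S (time_invariant d) k u t = ((k - t%:Z)%R, 0%R, 1%R).
      by rewrite /X => ->.
    elim: t => [|t /= ->]; first by rewrite /= subr0.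
    rewrite pup_win_opp winE subrr mul0r addr0 ltNge u0 /=; congr (_, _, _).
    lia.
  have Em : Eminus (X S (time_invariant d) k u).
    move=> M; exists (`|(M - k)%R|%N.+1) => n; rewrite XE; lia.
  rewrite /run_cost /terminal; case: asboolP => // _.
  rewrite KE subrr adde0; exact/geometric_stake_le/ltW.
Qed.

End Equilibrium.

Local Close Scope ereal_scope.

Lemma win_opponent_gt0 (x d : R) : 0 <= x -> 0 < d -> win x d = x / (d + x).
Proof. by move=> x0 d0; rewrite /win gt_eqF// ltr_wpDr. Qed.

(** Any positive stake beats zero surely, so a positive [c] could be halved at a profit. At [c = 0]
    the chance of winning is one half and a tiny stake would make it one; as this must not pay,
    winning cannot lower the future cost. *)
Lemma best_stake_vs_zero (c h l v : R) : 0 <= c ->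
  v = c + (win c 0 * h + (1 - win c 0) * l) ->
  (forall x, 0 <= x -> v <= x + (win x 0 * h + (1 - win x 0) * l)) ->
  c = 0 /\ l <= h.
Proof.
move=> c0 vE opt.
have win1 x : 0 < x -> win x 0 = 1.
  by move=> x0; rewrite /win add0r gt_eqF// divff// gt_eqF.
have cz : c = 0.
  apply/eqP; rewrite eq_le c0 andbT leNgt; apply/negP => cp.
  have c2 : 0 < c / 2 by rewrite divr_gt0.
  have := opt _ (ltW c2); rewrite vE !win1//; lra.
split=> //; have win0 : win 0 0 = 2^-1 by rewrite /win addr0 eqxx.
rewrite leNgt; apply/negP => hl.
(* A sure win would save [(l - h) / 2], twice the stake chosen here. *)
have e0 : 0 < (l - h) / 4 by rewrite divr_gt0// subr_gt0.
by have := opt _ (ltW e0); rewrite vE cz win0 win1//; lra.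
Qed.

(* First-order condition at an interior optimum, read off the two one-sided
   comparisons with nearby stakes. *)
Lemma best_stake_interior (c d h l v : R) : 0 < c -> 0 < d ->
  v = c + (win c d * h + (1 - win c d) * l) ->
  (forall x, 0 <= x -> v <= x + (win x d * h + (1 - win x d) * l)) ->
  (c + d) * (v - c) = c * h + d * l /\ (c + d) ^+ 2 = d * (l - h).
Proof.
move=> c0 d0 vE opt; have dc0 : d + c != 0 by rewrite gt_eqF// addr_gt0.
rewrite win_opponent_gt0 ?ltW// in vE.
split; first by rewrite vE; field.
set D := l - h.
(* After clearing the positive denominators, the difference of the costs of staking [x] and [c] has
   [x - c] as a factor. *)
have key x : 0 <= x -> 0 <= (x - c) * ((x + d) * (c + d) - d * D).
  move=> x0; have dx0 : 0 < d + x by rewrite ltr_wpDr.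
  have := opt _ x0; rewrite win_opponent_gt0// vE -subr_ge0 => h0.
  rewrite (_ : _ * _ = (x + (x / (d + x) * h + (1 - x / (d + x)) * l) -
    (c + (c / (d + c) * h + (1 - c / (d + c)) * l))) * ((d + x) * (d + c))).
    by rewrite mulr_ge0// mulr_ge0 ?addr_ge0// ltW.
  by rewrite /D; field; rewrite dc0 gt_eqF.
have cd0 : 0 < c + d by rewrite addr_gt0.
(* If the two sides differed, moving the stake from [c] by a small [y] in the right direction would
   make the product in [key] negative. Half the gap divided by [c + d] is small enough; when
   lowering the stake, [y] is also capped by [c]. *)
case: (ltgtP ((c + d) ^+ 2) (d * D)) => // hD.
- have [y y0 hy] : exists2 y, 0 < y & y * (c + d) < d * D - (c + d) ^+ 2.
    exists ((d * D - (c + d) ^+ 2) / 2 / (c + d)).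
      by rewrite !divr_gt0// subr_gt0.
    rewrite divfK ?gt_eqF//; lra.
  have := key (c + y) (addr_ge0 (ltW c0) (ltW y0)).
  by rewrite (_ : c + y - c = y) ?pmulr_rge0//; [lra|ring].
- have [y /andP[y0 yc] hy] : exists2 y, 0 < y <= c &
      y * (c + d) < (c + d) ^+ 2 - d * D.
    exists (Num.min c (((c + d) ^+ 2 - d * D) / 2 / (c + d))).
      by rewrite lt_min c0 ge_min lexx !divr_gt0// subr_gt0.
    apply: (@le_lt_trans _ _ (((c + d) ^+ 2 - d * D) / 2 / (c + d) * (c + d))).
      by rewrite ler_pM2r// ge_min lexx orbT.
    rewrite divfK ?gt_eqF//; lra.
  have := key (c - y); rewrite subr_ge0 => /(_ yc).
  by rewrite (_ : c - y - c = - y) ?nmulr_rge0 ?oppr_lt0//; [lra|ring].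
Qed.

End BestResponse.

(** * Escape probabilities *)

Section Balance.
Context {R : realType}.
Local Notation mu := (@lebesgue_measure R).
Local Notation D01 := (`[0%R, 1%R]%classic : set R).
Implicit Types (S Sm Sp : strategy R) (k : int).
Local Open Scope ereal_scope.

(** [terminal 0 1 0] is the indicator of escape to the right. *)
Definition right_prob Sm Sp k : R :=
  fine (\int[mu]_(u in D01) (terminal 0 1 0 (X Sm Sp k u))%:E).

Lemma terminal010 (x : nat -> int) : (0 <= terminal 0 1 0 x :> R)%R /\
  (terminal 0 1 0 x <= 1 :> R)%R.
Proof. by rewrite /terminal; case: ifP => _; [|case: ifP => _]; split. Qed.

Lemma right_probE Sm Sp k :
  \int[mu]_(u in D01) (terminal 0 1 0 (X Sm Sp k u))%:E = (right_prob Sm Sp k)%:E.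
Proof.
rewrite fineK// ge0_fin_numE; last first.
  by apply: integral_ge0 => u _; rewrite lee_fin (terminal010 _).1.
apply: (@le_lt_trans _ _ (\int[mu]_(u in D01) 1)); last first.
  by rewrite integral01_cst ltry.
apply: ge0_le_integral => //.
- by move=> u _; rewrite lee_fin (terminal010 _).1.
- by apply: measurable_funTS; apply/measurable_EFinP; exact: measurable_terminal.
- by move=> u _; rewrite lee_fin (terminal010 _).2.
Qed.

Lemma integral_right_probC Sm Sp k :
  \int[mu]_(u in D01) (1 - terminal 0 1 0 (X Sm Sp k u))%:E =
  (1 - right_prob Sm Sp k)%:E.
Proof.
under eq_integral do rewrite EFinB.
rewrite (@integral01_cstB _ 1%R) ?right_probE//.
  by apply: measurable_funTS; apply/measurable_EFinP; exact: measurable_terminal.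
by move=> u; rewrite lee_fin (terminal010 _).1.
Qed.

Lemma right_prob_ge0_le1 Sm Sp k : (0 <= right_prob Sm Sp k <= 1)%R.
Proof.
apply/andP; split.
  rewrite -lee_fin -right_probE; apply: integral_ge0 => u _.
  by rewrite lee_fin (terminal010 _).1.
rewrite -subr_ge0 -lee_fin -integral_right_probC; apply: integral_ge0 => u _.
by rewrite lee_fin subr_ge0 (terminal010 _).2.
Qed.

(** Almost sure escape removes the [star] case, and the terminal value becomes an affine function of
    the indicator of escape to the right. *)
Lemma integral_terminal_escapes (lo hi star K : R) Sm Sp k
    (q := right_prob Sm Sp k) : (lo <= K)%R -> (hi <= K)%R ->
  {ae mu, forall u, D01 u -> escapes (X Sm Sp k u)} ->
  \int[mu]_(u in D01) (K - terminal lo hi star (X Sm Sp k u))%:E =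
  ((K - lo) * (1 - q) + (K - hi) * q)%:E.
Proof.
move=> loK hiK esc.
have mI : measurable_fun D01 (fun u => (terminal 0 1 0 (X Sm Sp k u) : R)).
  by apply: measurable_funTS; exact: measurable_terminal.
have mI1 : measurable_fun D01 (fun u => (1 - terminal 0 1 0 (X Sm Sp k u) : R)%R).
  by apply: measurable_funB.
have I0 u := (@terminal010 (X Sm Sp k u)).1.
have I1 u : (0 <= 1 - terminal 0 1 0 (X Sm Sp k u) :> R)%R.
  by rewrite subr_ge0 (terminal010 _).2.
transitivity (\int[mu]_(u in D01)
   ((K - lo)%:E * (1 - terminal 0 1 0 (X Sm Sp k u))%:E +
    (K - hi)%:E * (terminal 0 1 0 (X Sm Sp k u))%:E)).
  apply: ae_eq_integral => //.
  - by apply: measurable_funTS; exact: measurable_K_terminal.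
  - apply: emeasurable_funD; apply: measurable_funeM; exact/measurable_EFinP.
  - move: esc; apply: negligibleS; apply: subsetC => u esc Du.
    rewrite -!EFinM -EFinD; congr (_%:E); rewrite /terminal.
    case: asboolP => [_|Em]; first by ring.
    case: asboolP => [_|Ep]; first by ring.
    by case: (esc Du).
rewrite ge0_integralD//.
- rewrite !ge0_integralZl_EFin ?subr_ge0//; last 4 first.
  + by move=> u _; rewrite lee_fin.
  + exact/measurable_EFinP.
  + by move=> u _; rewrite lee_fin.
  + exact/measurable_EFinP.
  by rewrite right_probE integral_right_probC.
- by move=> u _; apply: mule_ge0; rewrite lee_fin; [rewrite subr_ge0|exact: I1].
- by apply: measurable_funeM; exact/measurable_EFinP.
- by move=> u _; apply: mule_ge0; rewrite lee_fin; [rewrite subr_ge0|exact: I0].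
- by apply: measurable_funeM; exact/measurable_EFinP.
Qed.

(* The value [v k] is both the expected payoff with the given terminal values
   and, by the martingale argument, the one with the limits of [v] as terminal
   values; the expected stakes being finite, the terminal parts agree. *)
Lemma terminal_balance (v c : int -> R) (lo hi lo' hi' star K : R) Sm Sp k
    (q := right_prob Sm Sp k) :
  (lo <= K)%R -> (hi <= K)%R -> (star <= K)%R ->
  (forall i, 0 < c i)%R -> is_strategy Sm -> is_strategy Sp ->
  (forall x, star <= v x <= K)%R ->
  ((fun n : nat => v (- n%:Z)%R) @ \oo --> lo') ->
  ((fun n : nat => v n%:Z) @ \oo --> hi') ->
  (forall x t, pup Sm Sp x t.+1 * v (x + 1)%R +
    (1 - pup Sm Sp x t.+1) * v (x - 1)%R - c x = v x)%R ->
  cost lo hi star K (time_invariant c) Sm Sp k = (K - v k)%:E ->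
  ((1 - q) * lo' + q * hi' = (1 - q) * lo + q * hi)%R /\
  (v k <= (1 - q) * lo + q * hi)%R.
Proof.
move=> loK hiK sK c0 hm hp vb vlo vhi eqn costk.
have hc : is_strategy (time_invariant c) by move=> i t; exact/ltW/c0.
pose w x := (K - v x)%R.
have wb x : (0 <= w x <= K - star)%R by have := vb x; rewrite /w => /andP[]; lra.
have w0 x : (0 <= w x)%R by have /andP[] := wb x.
have lo'K : (lo' <= K)%R.
  by apply: (cvgr_to_le vlo); apply: nearW => n; have /andP[] := vb (- n%:Z)%R.
have hi'K : (hi' <= K)%R.
  by apply: (cvgr_to_le vhi); apply: nearW => n; have /andP[] := vb n%:Z.
have wlo : (fun n : nat => w (- n%:Z)%R) @ \oo --> (K - lo')%R.
  by apply: cvgB => //; exact: cvg_cst.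
have whi : (fun n : nat => w n%:Z) @ \oo --> (K - hi')%R.
  by apply: cvgB => //; exact: cvg_cst.
have hw x t : (c x + (pup Sm Sp x t.+1 * w (x + 1)%R +
    (1 - pup Sm Sp x t.+1) * w (x - 1)%R) = w x)%R.
  by rewrite /w -[v x](eqn x t); ring.
have hwle x t : (c x + (pup Sm Sp x t.+1 * w (x + 1)%R +
    (1 - pup Sm Sp x t.+1) * w (x - 1)%R) <= w x)%R by rewrite hw.
have stake_fin := integral_total_stake_le k hc hm hp w0 hwle.
have stake_ge0 : 0 <= \int[mu]_(u in D01) total_stake (time_invariant c) (X Sm Sp k u).
  by apply: integral_ge0 => u _; exact: total_stake_ge0.
have esc : {ae mu, forall u, D01 u -> escapes (X Sm Sp k u)}.
  by apply: (@ae_escapes _ c) => //; apply: (le_lt_trans stake_fin); exact: ltry.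
(* The step equations do not involve the terminal data, so both bounds on the cost apply with the
   limits of [v] as terminal values. *)
have cost' : cost lo' hi' star K (time_invariant c) Sm Sp k = (w k)%:E.
  apply/eqP; rewrite eq_le; apply/andP; split.
    exact: cost_le_supersolution.
  by apply: subsolution_le_cost => // x t; rewrite hw.
(* Both costs contain the same finite expected stake [r]: cancelling it gives the balance, and
   [r >= 0] gives the bound on [v k]. *)
move: costk cost' stake_fin stake_ge0; rewrite !costE//.
rewrite !integral_terminal_escapes// -/q.
case: (\int[mu]_(u in D01) total_stake _ _) => // r.
rewrite -!EFinD => -[h1] -[h2] _; rewrite lee_fin => r0.
rewrite /w in h2; split; nra.
Qed.

End Balance.

(** * From Nash to ABMN *)

Section NashtoABMN.
Context {R : realType}.

Lemma cstB_le_inj (K : R) (x y : \bar R) : (K%:E - x <= K%:E - y -> y <= x)%E.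
Proof.
by case: x => [x||]; case: y => [y||]//=; rewrite ?leey ?leNye// !lee_fin; lra.
Qed.

Lemma int_step_ind (P : int -> Prop) i : P i -> (forall j, P j -> P (j + 1)) ->
  (forall j, P j -> P (j - 1)) -> forall j, P j.
Proof.
move=> Pi up down j.
have h n : P (i + n%:Z) /\ P (i - n%:Z).
  elim: n => [|n [IH1 IH2]]; first by rewrite !(addr0, subr0).
  have -> : i + n.+1%:Z = i + n%:Z + 1 by lia.
  have -> : i - n.+1%:Z = i - n%:Z - 1 by lia.
  by split; [exact: up|exact: down].
have := h `|(j - i)%R|%N => -[h1 h2].
have [ij|ji] := leP i j.
  by have -> : j = i + `|(j - i)%R|%N%:Z by lia.
by have -> : j = i - `|(j - i)%R|%N%:Z by lia.
Qed.

Lemma nondecreasing_int_cvg (v : int -> R) A B : (forall i, v i <= v (i + 1)) ->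
  (forall i, A <= v i <= B) ->
  exists lo hi : R, (fun n : nat => v (- n%:Z)) @ \oo --> lo /\
    (fun n : nat => v n%:Z) @ \oo --> hi.
Proof.
move=> vS vb; have mon := nondecreasing_int vS.
pose f n := - v (- n%:Z); pose g (n : nat) := v n%:Z.
have cf : cvgn f.
  apply: nondecreasing_is_cvgn; first by move=> i j ij; rewrite lerN2; apply: mon; lia.
  by exists (- A) => _ [n _ <-]; rewrite lerN2; have /andP[] := vb (- n%:Z).
have cg : cvgn g.
  apply: nondecreasing_is_cvgn; first by move=> i j ij; apply: mon; lia.
  by exists B => _ [n _ <-]; have /andP[] := vb n%:Z.
exists (- limn f), (limn g); split; last exact: cg.
by rewrite (_ : (fun n : nat => v (- n%:Z)) = (fun n => - f n));
  [exact: cvgN|apply/funext => n; rewrite opprK].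
Qed.

(** Affine functions of [q] that agree at two distinct points coincide. *)
Lemma balance_eq (lo hi lo' hi' q1 q2 : R) : q1 < q2 ->
  (1 - q1) * lo' + q1 * hi' = (1 - q1) * lo + q1 * hi ->
  (1 - q2) * lo' + q2 * hi' = (1 - q2) * lo + q2 * hi -> lo' = lo /\ hi' = hi.
Proof.
move=> q12 h1 h2; have q0 : q2 - q1 != 0 by rewrite subr_eq0 gt_eqF.
have e : hi' - lo' = hi - lo by apply: (mulfI q0); lra.
have : lo' + q1 * (hi' - lo') = lo + q1 * (hi - lo) by lra.
by rewrite e => h; split; lra.
Qed.

(* If neither player ever stakes, both could secure their best terminal value,
   but the two best outcomes are incompatible. *)
Lemma not_both_costless (mlo mhi nlo nhi ms ns : R) (Sm Sp : strategy R) k :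
  mlo < mhi -> nhi < nlo -> ms <= mlo -> ns <= nhi ->
  is_strategy Sm -> is_strategy Sp ->
  cost mlo mhi ms mhi Sp Sm Sp k = 0%E -> cost nlo nhi ns nlo Sm Sm Sp k = 0%E ->
  False.
Proof.
move=> mlh nhl msl nsh hm hp c1 c2.
(* Escape to the left costs Maxine [mhi - mlo], escape to the right costs Mina [nlo - nhi], and no
   escape costs each of them at least that; so the summed costs are at least [dl] on every path. *)
pose dl := Num.min (mhi - mlo) (nlo - nhi).
have dl0 : 0 < dl by rewrite lt_min !subr_gt0 mlh nhl.
have mT x : terminal mlo mhi ms x <= mhi by apply: terminal_le; lra.
have nT x : terminal nlo nhi ns x <= nlo by apply: terminal_le; lra.
suff : (dl%:E <= 0)%E by rewrite lee_fin leNgt dl0.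
rewrite -[leRHS]adde0 -{1}c1 -c2 /cost -ge0_integralD//; last 4 first.
- by move=> u _; apply: run_cost_ge0 => //; lra.
- by apply: measurable_funTS; exact: measurable_run_cost.
- by move=> u _; apply: run_cost_ge0 => //; lra.
- by apply: measurable_funTS; exact: measurable_run_cost.
rewrite -[leLHS]integral01_cst; apply: ge0_le_integral => //.
- by move=> u _; rewrite lee_fin ltW.
- apply: measurable_funTS.
  by apply: emeasurable_funD; exact: measurable_run_cost.
move=> u _; set x := X Sm Sp k u.
apply: (@le_trans _ _ ((mhi - terminal mlo mhi ms x)%:E +
                       (nlo - terminal nlo nhi ns x)%:E)%E).
  rewrite -EFinD lee_fin /dl /terminal.
  by case: ifP => _; [|case: ifP => _]; rewrite ge_min; apply/orP; try (by left; lra);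
    right; lra.
by apply: leeD; rewrite /run_cost leeDr// total_stake_ge0.
Qed.

Lemma Nash_ABMN (mlo mhi nlo nhi ms ns : R) (a b : int -> R) :
  mlo < mhi -> nhi < nlo -> ms <= mlo -> ns <= nhi ->
  (forall i, 0 <= a i) -> (forall i, 0 <= b i) ->
  Nash mlo mhi nlo nhi ms ns (time_invariant b) (time_invariant a) ->
  [/\ (forall i, Eplus_payoff mlo mhi ms (time_invariant b) (time_invariant a) i
                    \is a fin_num),
      (forall i, Eminus_payoff nlo nhi ns (time_invariant b) (time_invariant a) i
                    \is a fin_num) &
      positive_ABMN_bd a b
        (fun i => fine (Eplus_payoff mlo mhi ms (time_invariant b) (time_invariant a) i))
        (fun i => fine (Eminus_payoff nlo nhi ns (time_invariant b) (time_invariant a) i))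
        mlo mhi nlo nhi].
Proof.
move=> mlh nhl msl nsh a0 b0 nash.
have ha : is_strategy (time_invariant a) by move=> i t; exact: a0.
have hb : is_strategy (time_invariant b) by move=> i t; exact: b0.
have mlo_le : mlo <= mhi by exact: ltW.
have nhi_le : nhi <= nlo by exact: ltW.
have ms_le : ms <= mhi by lra.
have ns_le : ns <= nlo by lra.
have bestm S : is_strategy S -> forall k,
    (side_cost true mlo mhi ms mhi (time_invariant a) (time_invariant b) k <=
     side_cost true mlo mhi ms mhi S (time_invariant b) k)%E.
  move=> hS k; have [+ _] := nash S hS k.
  by rewrite !(@EplusE _ _ _ _ mhi)//; exact: cstB_le_inj.
have bestn S : is_strategy S -> forall k,
    (side_cost false nlo nhi ns nlo (time_invariant b) (time_invariant a) k <=
     side_cost false nlo nhi ns nlo S (time_invariant a) k)%E.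
  move=> hS k; have [_] := nash S hS k.
  by rewrite !(@EminusE _ _ _ _ nlo)//; exact: cstB_le_inj.
pose wm := eq_cost_value true mlo mhi ms mhi a b.
pose wn := eq_cost_value false nlo nhi ns nlo b a.
have cm k : cost mlo mhi ms mhi (time_invariant a) (time_invariant b) (time_invariant a) k
    = (wm k)%:E.
  by rewrite -[LHS]/(side_cost true mlo mhi ms mhi (time_invariant a) (time_invariant b) k)
    eq_cost_valueE.
have cn k : cost nlo nhi ns nlo (time_invariant b) (time_invariant b) (time_invariant a) k
    = (wn k)%:E.
  by rewrite -[LHS]/(side_cost false nlo nhi ns nlo (time_invariant b) (time_invariant a) k)
    eq_cost_valueE.
have Ep k : Eplus_payoff mlo mhi ms (time_invariant b) (time_invariant a) k
    = (mhi - wm k)%:E by rewrite (@EplusE _ _ _ _ mhi)// cm.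
have En k : Eminus_payoff nlo nhi ns (time_invariant b) (time_invariant a) k
    = (nlo - wn k)%:E by rewrite (@EminusE _ _ _ _ nlo)// cn.
split; [by move=> i; rewrite Ep|by move=> i; rewrite En|].
under eq_fun do rewrite Ep.
rewrite (_ : (fun i => fine (Eminus_payoff _ _ _ _ _ i)) = (fun i => nlo - wn i)); last first.
  by apply/funext => i; rewrite En.
rewrite /=.
pose m i := mhi - wm i; pose n i := nlo - wn i.
rewrite -[fun i => mhi - _]/m -[fun i => nlo - _]/n.
have mstep i : wm i = a i + (win (a i) (b i) * wm (i + 1) + (1 - win (a i) (b i)) * wm (i - 1)).
  exact: (@eq_cost_value_step _ true).
have nstep i : wn i = b i + (win (b i) (a i) * wn (i - 1) + (1 - win (b i) (a i)) * wn (i + 1)).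
  exact: (@eq_cost_value_step _ false).
have mdev i x : 0 <= x ->
    wm i <= x + (win x (b i) * wm (i + 1) + (1 - win x (b i)) * wm (i - 1)).
  exact: (@eq_cost_value_deviation _ true).
have ndev i x : 0 <= x ->
    wn i <= x + (win x (a i) * wn (i - 1) + (1 - win x (a i)) * wn (i + 1)).
  exact: (@eq_cost_value_deviation _ false).
(* If one player stakes nothing at a site, so does the other: [bz] starts from Mina, [az] from
   Maxine, and [dich] combines them. *)
have bz i : b i = 0 -> a i = 0 /\ wm (i - 1) <= wm (i + 1).
  move=> bi; apply: (@best_stake_vs_zero _ _ _ _ (wm i)) => //.
    by rewrite {1}mstep bi.
  by move=> x x0; have := mdev i x x0; rewrite bi.
have az i : a i = 0 -> b i = 0.
  move=> ai; have [] // := @best_stake_vs_zero _ (b i) (wn (i - 1)) (wn (i + 1)) (wn i) (b0 i).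
    by rewrite {1}nstep ai.
  by move=> x x0; have := ndev i x x0; rewrite ai.
have dich i : (a i = 0 /\ b i = 0) \/ (0 < a i /\ 0 < b i).
  have [ai|ai] := eqVneq (a i) 0; first by left; split=> //; exact: az.
  right; rewrite !lt_neqAle a0 b0 eq_sym ai eq_sym !andbT; split=> //.
  by apply: contra ai => /eqP/bz[->].
have posm i : 0 < a i -> 0 < b i ->
    (a i + b i) * (m i + a i) = a i * m (i + 1) + b i * m (i - 1) /\
    (a i + b i) ^+ 2 = b i * (m (i + 1) - m (i - 1)).
  move=> ai bi; have [h1 h2] := best_stake_interior ai bi (mstep i) (mdev i).
  rewrite h2 /m; split; last by ring.
  transitivity ((a i + b i) * mhi - (a i + b i) * (wm i - a i)); first by ring.
  by rewrite h1; ring.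
have posn i : 0 < a i -> 0 < b i ->
    (b i + a i) * (n i + b i) = b i * n (i - 1) + a i * n (i + 1) /\
    (b i + a i) ^+ 2 = a i * (n (i - 1) - n (i + 1)).
  move=> ai bi; have [h1 h2] := best_stake_interior bi ai (nstep i) (ndev i).
  rewrite h2 /n; split; last by ring.
  transitivity ((b i + a i) * nlo - (b i + a i) * (wn i - b i)); first by ring.
  by rewrite h1; ring.
have incm i : 0 < a i -> 0 < b i -> m (i - 1) < m i < m (i + 1).
  by move=> ai bi; have [h1 h2] := posm i ai bi; exact: ABMN_increasing ai bi h1 h2.
have decn i : 0 < a i -> 0 < b i -> n (i + 1) < n i < n (i - 1).
  by move=> ai bi; have [h1 h2] := posn i ai bi; exact: ABMN_increasing bi ai h1 h2.
have zm i : a i = 0 -> b i = 0 -> wm (i - 1) <= wm i <= wm (i + 1).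
  move=> ai bi; have [_ h] := bz i bi; have := mstep i.
  by rewrite ai bi /win addr0 eqxx => ->; lra.
have pos i : 0 < a i /\ 0 < b i.
  have [z|//] := dich i; exfalso.
  (* A zero site cannot adjoin a positive one: between the two, [m] would be nonincreasing by the
     first and strictly increasing by the second. *)
  have allz : forall j, a j = 0 /\ b j = 0.
    apply: int_step_ind z _ _ => j [aj bj].
      have [//|[a1 b1]] := dich (j + 1).
      have /andP[_ h1] := zm j aj bj.
      by have := incm _ a1 b1; rewrite addrK /m => /andP[]; lra.
    have [//|[a1 b1]] := dich (j - 1).
    have /andP[h1 _] := zm j aj bj.
    by have := incm _ a1 b1; rewrite subrK /m => /andP[]; lra.
  apply: (@not_both_costless mlo mhi nlo nhi ms ns (time_invariant b) (time_invariant a) 0) => //.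
    rewrite cm /wm unopposed_cost// => j; by have [] := allz j.
  rewrite cn /wn unopposed_cost// => j; by have [] := allz j.
have ai i : 0 < a i by have [] := pos i.
have bi i : 0 < b i by have [] := pos i.
have mb i : ms <= m i <= mhi.
  have : 0 <= wm i <= mhi - ms by apply: eq_cost_value_bounds.
  by rewrite /m => /andP[]; lra.
have nb i : ns <= n i <= nlo.
  have : 0 <= wn i <= nlo - ns by apply: eq_cost_value_bounds.
  by rewrite /n => /andP[]; lra.
have mS i : m i < m (i + 1) by have /andP[] := incm i (ai i) (bi i).
have nS i : n (i + 1) < n i by have /andP[] := decn i (ai i) (bi i).
have [mlo' [mhi' [mlo_cvg mhi_cvg]]] :=
  nondecreasing_int_cvg (fun i => ltW (mS i)) mb.
have [nlo' [nhi' [nlo_cvg nhi_cvg]]] : exists nlo' nhi' : R,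
    (fun k : nat => n (- k%:Z)) @ \oo --> nlo' /\ (fun k : nat => n k%:Z) @ \oo --> nhi'.
  have [||l [h [hl hh]]] := @nondecreasing_int_cvg (fun i => - n i) (- nlo) (- ns).
  - by move=> i; rewrite lerN2 ltW.
  - by move=> i; rewrite !lerN2 andbC.
  exists (- l), (- h); split.
    rewrite (_ : (fun k : nat => n (- k%:Z)) = fun k : nat => - - n (- k%:Z)).
      exact: cvgN.
    by apply/funext => k; rewrite opprK.
  rewrite (_ : (fun k : nat => n k%:Z) = fun k : nat => - - n k%:Z).
    exact: cvgN.
  by apply/funext => k; rewrite opprK.
pose q := right_prob (time_invariant b) (time_invariant a).
have q01 k : 0 <= q k <= 1 by exact: right_prob_ge0_le1.
have mbal k : (1 - q k) * mlo' + q k * mhi' = (1 - q k) * mlo + q k * mhi /\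
    m k <= (1 - q k) * mlo + q k * mhi.
  apply: (@terminal_balance _ m a _ _ _ _ ms mhi) => //.
    by move=> x t; rewrite pup_win /m (mstep x) /time_invariant; ring.
  by rewrite cm /m; congr (_%:E); ring.
have nbal k : (1 - q k) * nlo' + q k * nhi' = (1 - q k) * nlo + q k * nhi /\
    n k <= (1 - q k) * nlo + q k * nhi.
  apply: (@terminal_balance _ n b _ _ _ _ ns nlo) => //.
    by move=> x t; rewrite pup_win_opp /n (nstep x) /time_invariant; ring.
  by rewrite cn /n; congr (_%:E); ring.
have mlh' : mlo' < mhi'.
  have h := nondecreasing_int_bounds (fun i => ltW (mS i)) mlo_cvg mhi_cvg.
  by have /andP[h0 _] := h 0; have /andP[_ h1] := h (0 + 1); have := mS 0; lra.
have nhl' : nhi' < nlo'.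
  have h i : - nlo' <= - n i <= - nhi'.
    apply: (@nondecreasing_int_bounds _ (fun i => - n i)) i.
    - by move=> j; rewrite lerN2 ltW.
    - exact: cvgN.
    - exact: cvgN.
  by have /andP[h0 _] := h 0; have /andP[_ h1] := h (0 + 1); have := nS 0; lra.
(* Far to the right [m] exceeds the midpoint of its limits, while the balance bounds it by their
   average with weight [q] on [mhi']; hence [q] exceeds one half. The values of [n] far to the left
   give [k2] in the same way. *)
have [k1 hk1] : exists k, 1 / 2 < q k.
  have : (mlo' + mhi') / 2 < mhi' by lra.
  move=> /(cvgr_gt _ mhi_cvg)[N _ /(_ N (leqnn N))] /= h; exists N%:Z.
  have [h1 h2] := mbal N%:Z; rewrite -h1 in h2.
  by rewrite ltNge; apply/negP => h3; nra.
have [k2 hk2] : exists k, q k < 1 / 2.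
  have : (nlo' + nhi') / 2 < nlo' by lra.
  move=> /(cvgr_gt _ nlo_cvg)[N _ /(_ N (leqnn N))] /= h; exists (- N%:Z).
  have [h1 h2] := nbal (- N%:Z); rewrite -h1 in h2.
  by rewrite ltNge; apply/negP => h3; nra.
have q21 : q k2 < q k1 by lra.
have [me1 me2] := balance_eq q21 (mbal k2).1 (mbal k1).1.
have [ne1 ne2] := balance_eq q21 (nbal k2).1 (nbal k1).1.
split => //; last by rewrite -me1 -me2 -ne1 -ne2.
move=> i; have [h1 h2] := posm i (ai i) (bi i); have [h3 h4] := posn i (ai i) (bi i).
split; split=> //; first by rewrite addrC h3 addrC.
by rewrite addrC h4.
Qed.

End NashtoABMN.

Theorem mainTheorem3 (R : realType) (mlo mhi nlo nhi ms ns : R) :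
  mlo < mhi -> nhi < nlo -> ms <= mlo -> ns <= nhi ->
  (* (1) time-invariant Nash equilibria give positive ABMN solutions *)
  (forall a b : int -> R, (forall i, 0 <= a i) -> (forall i, 0 <= b i) ->
     Nash mlo mhi nlo nhi ms ns (time_invariant b) (time_invariant a) ->
     [/\ (forall i, Eplus_payoff mlo mhi ms (time_invariant b) (time_invariant a) i
                      \is a fin_num),
         (forall i, Eminus_payoff nlo nhi ns (time_invariant b) (time_invariant a) i
                      \is a fin_num) &
         positive_ABMN_bd a b
           (fun i => fine (Eplus_payoff mlo mhi ms (time_invariant b) (time_invariant a) i))
           (fun i => fine (Eminus_payoff nlo nhi ns (time_invariant b) (time_invariant a) i))
           mlo mhi nlo nhi]) /\
  (* (2) positive ABMN solutions give time-invariant Nash equilibria *)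
  (forall a b m n : int -> R,
     positive_ABMN_bd a b m n mlo mhi nlo nhi ->
     Nash mlo mhi nlo nhi ms ns (time_invariant b) (time_invariant a)).
Proof.
move=> mlh nhl msl nsh; split; first by move=> a b a0 b0; exact: Nash_ABMN.
by move=> a b m n; exact: ABMN_Nash.
Qed.
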